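(* Consider the distributed problem with $L$-Lipschitz gradients, the stochastic oracle with variance bound $\sigma^2$, and the LocalSGD algorithm with communication interval $\tau\ge 2$, $R$ communication rounds and $T=\tau R$ iterations, all as described in the context. Assume: (i) (standard gradient similarity) for some $\zeta\ge 0$, $\sup_{\mathbf x\in\mathbb R^d}\frac1n\sum_{i=1}^n\|\nabla f_i(\mathbf x)-\nabla f(\mathbf x)\|_2^2\le\zeta^2$; (ii) all the local functions $f_i$ are convex; (iii) $\mathbf x^*\in\arg\min_{\mathbf x\in\mathbb R^d}f(\mathbf x)$, and there exists some $D\ge0$ such that $\|\bar{\mathbf x}_0-\mathbf x^*\|_2\le D$. Then there exists $\eta>0$ such that LocalSGD with stepsize $\eta$ ensures the following upper bound: $$\frac1T\sum_{t=0}^{T-1}\mathbb E[f(\bar{\mathbf x}_t)]-f^*\le \mathcal O\left(\frac{LD^2}{\tau R}+\frac{\sigma D}{\sqrt{n\tau R}}+\Big(\frac{L\zeta^2D^4}{R^2}\Big)^{1/3}+\Big(\frac{L\sigma^2D^4}{\tau R^2}\Big)^{1/3}\right),$$ where $\mathcal O(\cdot)$ hides an absolute numerical constant.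
   Context: Setting. There are $n$ workers and local functions $f_1,\dots,f_n:\mathbb R^d\to\mathbb R$, each with $L$-Lipschitz continuous gradient, $L>0$. Put $f=\frac1n\sum_{i=1}^n f_i$, assumed bounded below, and $f^*=\inf_{\mathbf x\in\mathbb R^d}f(\mathbf x)$. $\|\cdot\|_2$ is the Euclidean norm. Stochastic oracle. At iteration $t\in\{0,\dots,T-1\}$, worker $i$ at point $\mathbf x_t^i$ receives $\mathbf g_t^i=G_i(\mathbf x_t^i,\xi_t^i)$, where $G_i$ is a Borel function, $\{\xi_t^i: 0\le t\le T-1\}$ are i.i.d. random variables for each $i\in\{1,\dots,n\}$, and $\mathbb E_{\xi_t^i}[G_i(\mathbf x,\xi_t^i)]=\nabla f_i(\mathbf x)$ and $\mathbb E_{\xi_t^i}\|G_i(\mathbf x,\xi_t^i)-\nabla f_i(\mathbf x)\|_2^2\le\sigma^2$. LocalSGD. Let $\tau\ge2$ be an integer (communication interval), $T$ the total number of iterations, assumed to be a multiple of $\tau$, $R=T/\tau$ the number of communication rounds, and $\eta>0$ the stepsize. The workers start from a common point $\mathbf x_0^1=\dots=\mathbf x_0^n$, and $\bar{\mathbf x}_t=\frac1n\sum_{i=1}^n\mathbf x_t^i$. For each $i\in\{1,\dots,n\}$ and $t\in\{0,\dots,T-1\}$: if $t+1$ is a multiple of $\tau$, then $\mathbf x_{t+1}^i=\bar{\mathbf x}_{t-\tau+1}-\frac{\eta}{n}\sum_{j=1}^n\sum_{k=0}^{\tau-1}\mathbf g_{t-k}^j$; otherwise $\mathbf x_{t+1}^i=\mathbf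 x_t^i-\eta\,\mathbf g_t^i$.
   Formalization: If D = 0, the formal theorem also assumes σ = ζ = 0 (otherwise the right side is 0 while η > 0 and the bound fails), and the oracle noises are assumed independent across workers as well as over time, without which the term σD/√(nτR) is false. *)

(* Defs.v *)
From HB Require Import structures.
From mathcomp Require Import all_boot all_order all_algebra.
From mathcomp Require Import all_classical all_reals all_analysis.

Set Implicit Arguments.
Unset Strict Implicit.
Unset Printing Implicit Defensive.

Import Order.TTheory GRing.Theory Num.Theory.
Import numFieldNormedType.Exports.

Local Open Scope classical_set_scope.
Local Open Scope ring_scope.

(* The norm `|x| that the library puts on 'rV[R]_d is the sup norm, whence this
   definition. *)
Definition norm2 (R : realType) (d : nat) (x : 'rV[R]_d) : R :=
  Num.sqrt (\sum_(j < d) x 0 j ^+ 2).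

Definition grad (R : realType) (d : nat) (f : 'rV[R]_d -> R) (x : 'rV[R]_d) :
    'rV[R]_d :=
  \row_(j < d) 'D_(delta_mx 0 j) f x.

Definition lipschitz_gradient (R : realType) (d : nat) (L : R)
    (f : 'rV[R]_d -> R) : Prop :=
  (forall x, differentiable f x) /\
  (forall x y, norm2 (grad f x - grad f y) <= L * norm2 (x - y)).

(* R^d with its Borel sigma-algebra: the topology of 'rV[R]_d is the usual one. *)
Definition borel_rV (R : realType) (d : nat) :=
  g_sigma_algebraType (@open 'rV[R]_d).

Definition borel_function (R : realType) (d : nat) (dX : measure_display)
    (X : measurableType dX) (G : 'rV[R]_d -> X -> 'rV[R]_d) : Prop :=
  measurable_fun [set: (borel_rV R d * X)%type]
    (fun p : borel_rV R d * X => G p.1 p.2 : borel_rV R d).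

(* Mutual independence of a finite family of random variables with values in
   possibly different measurable spaces. *)
Definition mutually_independent (R : realType) (dO : measure_display)
    (Omega : measurableType dO) (P : probability Omega R) (I : finType)
    (dX : measure_display) (X : I -> measurableType dX)
    (Y : forall k : I, Omega -> X k) : Prop :=
  forall (J : {set I}) (A : forall k : I, set (X k)),
    (forall k, measurable (A k)) ->
    P (\bigcap_(k in [set` J]) (Y k @^-1` A k)) =
    (\prod_(k in J) P (Y k @^-1` A k))%E.

Definition worker_mean (V : Type) (R : realType) (n d : nat)
    (F : 'I_n -> V -> 'rV[R]_d) : V -> 'rV[R]_d :=
  fun v => n%:R^-1 *: \sum_(i < n) F i v.

Definition objective (R : realType) (n d : nat) (f : 'I_n -> 'rV[R]_d -> R) :
    'rV[R]_d -> R :=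
  fun x => n%:R^-1 * \sum_(i < n) f i x.

(* [x t i w] is the iterate of worker [i] at time [t] on the outcome [w]. The
   equations determine [x t] uniquely for [t <= T]; the other times are left
   unconstrained. The subtraction [t.+1 - tau] is not truncated, as it is only
   used when [tau] divides [t.+1]. *)
Definition local_sgd (R : realType) (n d tau T : nat) (eta : R)
    (Omega : Type) (X : 'I_n -> Type)
    (G : forall i : 'I_n, 'rV[R]_d -> X i -> 'rV[R]_d)
    (xi : forall i : 'I_n, nat -> Omega -> X i)
    (x0 : 'rV[R]_d) (x : nat -> 'I_n -> Omega -> 'rV[R]_d) : Prop :=
  let g t i w := G i (x t i w) (xi i t w) in
  (forall i w, x 0%N i w = x0) /\
  (forall t i w, (t < T)%N ->
     x t.+1 i w =
       if (tau %| t.+1)%N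
       then worker_mean (x (t.+1 - tau)%N) w
            - (eta / n%:R) *: \sum_(j < n) \sum_(k < tau) g (t - k)%N j w
       else x t i w - eta *: g t i w).

(* Main.v *)
Require Import Defs.
From HB Require Import structures.
From mathcomp Require Import all_boot all_order all_algebra.
From mathcomp Require Import all_classical all_reals all_analysis.
From mathcomp Require Import measurable_realfun ring lra zify.

Import Order.TTheory GRing.Theory Num.Theory.
Import numFieldNormedType.Exports.

Local Open Scope classical_set_scope.
Local Open Scope ring_scope.

(** Write [xb t] for the mean of the local iterates. Communication replaces them
    by their mean, so [xb] always moves by [- eta] times the mean of the stochastic
    gradients (lemmas [local_sgd_step] and [worker_mean_step]).

    The argument rests on two recursions, with [eta <= 1 / (4 L)].
    - [sqdist_step]: in one step, E|xb - xs|^2 decreases by [eta] times the expected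
      optimality gap of [xb], up to the noise term [eta^2 sigma^2 / n] and
      (3/2) eta L times the mean over the workers of the dispersion E|x_i - xb|^2.
      Pointwise this is [averaged_step], a consequence of convexity, of the descent
      lemma, and of |grad F|^2 <= 2 L (F - F xs).
    - [dispersion_step]: between two communications, this mean dispersion is
      multiplied by [1 + 1/tau] and increased by (1 + tau) eta^2 zeta^2 + eta^2 sigma^2.
      Here each local step is compared with the gradient step of the objective
      from [xb]; a local gradient step being nonexpansive (which needs convexity),
      heterogeneity is only measured at the common point [xb], where the similarity
      hypothesis bounds the mean over the workers.
    Since the dispersion vanishes at each communication, it remains below
    3 tau ((1 + tau) eta^2 zeta^2 + eta^2 sigma^2). Summing the first recursion,
    the mean gap is at most D^2 / (eta T) + eta sigma^2 / n plus a multiple of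
    L tau eta^2 (tau zeta^2 + sigma^2), and [stepsize_choice] balances these terms.

    The noise is handled without conditional expectations. By mutual independence,
    the sigma-algebra generated by some of the oracle's random variables is
    independent of any other one, so that Tonelli's theorem allows one to freeze the
    past and integrate over a fresh copy of that variable ([freezing]). For a frozen
    past the oracle's noise is centered, hence it adds at most its variance to the
    squared norm of a past-determined vector ([sq_dist_oracle]). All integrals in
    the recursions are integrals of nonnegative functions with values in the
    extended reals; finiteness of the moments comes out of the final bound. *)

Set Implicit Arguments.
Unset Strict Implicit.
Unset Printing Implicit Defensive.

(** * Inner product of row vectors *)

Section InnerProduct.
Context {R : realType} {d : nat}.
Implicit Types (x y z : 'rV[R]_d) (c : R).

(** The Euclidean inner product. As [dot x x] is the square of [norm2 x]
    ([norm2_sq]), the estimates are stated without square roots. *)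
Definition dot x y : R := \sum_(j < d) x 0 j * y 0 j.

Lemma dotC x y : dot x y = dot y x.
Proof. by apply: eq_bigr => j _; rewrite mulrC. Qed.

Lemma dotDl x y z : dot (x + y) z = dot x z + dot y z.
Proof. by rewrite -big_split; apply: eq_bigr => j _; rewrite mxE mulrDl. Qed.

Lemma dotDr x y z : dot z (x + y) = dot z x + dot z y.
Proof. by rewrite !(dotC z) dotDl. Qed.

Lemma dotZl c x y : dot (c *: x) y = c * dot x y.
Proof. by rewrite mulr_sumr; apply: eq_bigr => j _; rewrite mxE mulrA. Qed.

Lemma dotZr c x y : dot x (c *: y) = c * dot x y.
Proof. by rewrite dotC dotZl dotC. Qed.

Lemma dotNl x y : dot (- x) y = - dot x y.
Proof. by rewrite -scaleN1r dotZl mulN1r. Qed.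

Lemma dotNr x y : dot x (- y) = - dot x y.
Proof. by rewrite dotC dotNl dotC. Qed.

Lemma dot0l x : dot 0 x = 0.
Proof. by rewrite -(scale0r 0) dotZl mul0r. Qed.

Lemma dot_suml (I : finType) (u : I -> 'rV[R]_d) x :
  dot (\sum_i u i) x = \sum_i dot (u i) x.
Proof.
apply: (big_morph (dot^~ x)) => [y z|]; first exact: dotDl.
exact: dot0l.
Qed.

Lemma dot_ge0 x : 0 <= dot x x.
Proof. by apply: sumr_ge0 => j _; rewrite -expr2 sqr_ge0. Qed.

Definition dotE := (dotDl, dotDr, dotNl, dotNr, dotZl, dotZr).

Lemma norm2_sq x : norm2 x ^+ 2 = dot x x.
Proof.
rewrite sqr_sqrtr; first by apply: eq_bigr => j _; rewrite expr2.
by apply: sumr_ge0 => j _; rewrite sqr_ge0.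
Qed.

Lemma norm2_ge0 x : 0 <= norm2 x.
Proof. exact: sqrtr_ge0. Qed.

Lemma norm2_le_sq x c : 0 <= c -> norm2 x <= c -> dot x x <= c ^+ 2.
Proof.
by move=> c0 xc; rewrite -norm2_sq ler_pXn2r ?nnegrE ?norm2_ge0.
Qed.

(** Young's inequality; it makes the Cauchy-Schwarz inequality unnecessary. *)
Lemma dot_young c x y : 0 < c -> 2 * dot x y <= c^-1 * dot x x + c * dot y y.
Proof.
move=> c0; have := dot_ge0 (c^-1 *: x - y).
rewrite !dotE (dotC y x) => h.
have /(mulr_ge0 (ltW c0)) := h.
set a := dot x x; set b := dot x y; set e := dot y y.
have -> : c * (c^-1 * (c^-1 * a) - c^-1 * b - (c^-1 * b - e)) =
          c^-1 * a - 2 * b + c * e by field; lra.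
by lra.
Qed.

(** The mean minimizes the sum of the squared distances to given vectors. *)
Lemma dot_sub_mean (n : nat) (u : 'I_n -> 'rV[R]_d) z : (0 < n)%N ->
  \sum_(i < n) dot (u i - n%:R^-1 *: \sum_i u i) (u i - n%:R^-1 *: \sum_i u i)
  <= \sum_(i < n) dot (u i - z) (u i - z).
Proof.
move=> n0; set m := n%:R^-1 *: _.
have nR : n%:R != 0 :> R by rewrite pnatr_eq0 -lt0n.
have sm : \sum_i u i = n%:R *: m by rewrite scalerA divff ?scale1r.
clearbody m.
have -> : \sum_(i < n) dot (u i - z) (u i - z) =
   \sum_(i < n) dot (u i - m) (u i - m) + \sum_(i < n) dot (m - z) (m - z)
   + 2 * dot (\sum_(i < n) (u i - m)) (m - z).
  rewrite dot_suml mulr_sumr -!big_split; apply: eq_bigr => i _ /=.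
  by rewrite !dotE (dotC z (u i)) (dotC m (u i)) (dotC m z); ring.
have -> : \sum_(i < n) (u i - m) = 0.
  by rewrite big_split /= sumrN sumr_const card_ord sm scaler_nat subrr.
rewrite dot0l mulr0 addr0 lerDl; apply: sumr_ge0 => i _; exact: dot_ge0.
Qed.

(** Jensen's inequality for the squared norm. *)
Lemma dot_mean (n : nat) (u : 'I_n -> 'rV[R]_d) : (0 < n)%N ->
  dot (n%:R^-1 *: \sum_i u i) (n%:R^-1 *: \sum_i u i)
  <= n%:R^-1 * \sum_(i < n) dot (u i) (u i).
Proof.
move=> n0; set m := n%:R^-1 *: _.
have n0R : 0 < n%:R :> R by rewrite ltr0n.
have nR : n%:R != 0 :> R by rewrite pnatr_eq0 -lt0n.
have sm : \sum_i u i = n%:R *: m by rewrite scalerA divff ?scale1r.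
clearbody m.
rewrite ler_pdivlMl //.
have : 0 <= \sum_(i < n) dot (u i - m) (u i - m).
  by apply: sumr_ge0 => i _; exact: dot_ge0.
have -> : \sum_(i < n) dot (u i - m) (u i - m) =
   \sum_(i < n) dot (u i) (u i) + \sum_(i < n) dot m m
   - 2 * dot (\sum_(i < n) u i) m.
  rewrite dot_suml mulr_sumr -sumrN -!big_split; apply: eq_bigr => i _ /=.
  by rewrite !dotE (dotC m (u i)); ring.
rewrite sm dotZl sumr_const card_ord -[_ *+ n]mulr_natl; lra.
Qed.

End InnerProduct.

(** * Convex functions with Lipschitz gradient *)

Section ConvexAnalysis.
Context {R : realType} {d : nat}.
Implicit Types (f : 'rV[R]_d -> R) (x y v : 'rV[R]_d).

Lemma derive_grad f x v : differentiable f x -> 'D_v f x = dot (grad f x) v.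
Proof.
move=> df; rewrite deriveE //.
rewrite {1}(row_sum_delta v) linear_sum /dot; apply: eq_bigr => j _.
by rewrite linearZ /= /grad mxE deriveE // mulrC.
Qed.

Lemma is_derive_line f x v (s : R) : (forall y, differentiable f y) ->
  is_derive s 1 (fun s : R => f (x + s *: v)) (dot (grad f (x + s *: v)) v).
Proof.
move=> df; rewrite -derive_grad //.
have E : (fun h : R => h^-1 *: (f (x + (h *: (1 : R) + s) *: v)
                                - f (x + s *: v))) =
         (fun h : R => h^-1 *: (f (h *: v + (x + s *: v)) - f (x + s *: v))).
  by apply/funext => h; rewrite /= scalerDl [h *: 1]mulr1 addrCA.
have Dfv : derivable f (x + s *: v) v by exact: diff_derivable.
apply: DeriveDef.
  by move: Dfv; rewrite /derivable /= -E.
by rewrite /derive /= -E.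
Qed.

(** Descent lemma: the quadratic upper bound for a function with Lipschitz
    gradient. *)
Lemma lipschitz_gradient_upper (L : R) f x y : 0 < L -> lipschitz_gradient L f ->
  f y <= f x + dot (grad f x) (y - x) + L / 2 * dot (y - x) (y - x).
Proof.
move=> L0 [df lf]; set v := y - x.
pose q := dot (grad f x) v; pose n2 := dot v v.
pose g := fun s : R => f (x + s *: v).
(* By the Lipschitz condition, the derivative of [h] is nonpositive on ]0, 1[;
   for the inner product in it, Young's inequality is used with constant [L * c]. *)
pose h (s : R) : R := g s - (q *: s + (L / 2 * n2) *: s ^+ 2).
have dh (s : R) : is_derive s 1 h (dot (grad f (x + s *: v)) v - (q + L * n2 * s)).
  apply: is_deriveB; first exact: is_derive_line.
  by apply: is_derive_eq; rewrite /GRing.scale /= !mulr1; field.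
have ch : {within `[0, 1], continuous h}.
  apply: (@derivable_within_continuous R R^o) => t _.
  by case: (dh t).
have [c /itvP cI] := MVT ltr01 (fun s _ => dh s) ch.
have xv : x + v = y by rewrite /v addrC subrK.
rewrite /h /g scale1r xv scale0r addr0; set u := grad f (x + c *: v) => E.
suff : dot u v - (q + L * n2 * c) <= 0.
  by move: E; rewrite /GRing.scale /= -/q -/n2; nra.
have c0 : 0 < c by rewrite cI.
have := dot_young (u - grad f x) v (mulr_gt0 L0 c0).
have := lf (x + c *: v) x; rewrite -/u [x + _]addrC addrK.
move=> /(norm2_le_sq (mulr_ge0 (ltW L0) (norm2_ge0 _))).
rewrite exprMn norm2_sq dotZl dotZr -/n2.
set a := dot (_ - _) (_ - _).
have -> : dot (u - grad f x) v = dot u v - q by rewrite dotDl dotNl.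
set b := dot u v => la.
have : (L * c)^-1 * a <= L * c * n2.
  by rewrite ler_pdivrMl ?mulr_gt0 //; nra.
by rewrite -/n2; lra.
Qed.

(** First-order lower bound for a differentiable convex function. *)
Lemma convex_lower f x y : (forall y, differentiable f y) ->
  convex_function [set: convex_lmodType 'rV[R]_d] f ->
  f x + dot (grad f x) (y - x) <= f y.
Proof.
move=> df cf; rewrite -derive_grad // -lerBrDl.
have Dfv : derivable f x (y - x) by exact: diff_derivable.
(* Convexity bounds the difference quotients along [y - x] for steps in ]0, 1]. *)
apply: (cvgr_to_le (cvg_dnbhs_at_right Dfv)).
near=> h => /=.
have h0 : 0 < h by near: h; exact: nbhs_right_gt.
have h1 : h <= 1 by near: h; exact: nbhs_right_le.
have hI : Itv.spec (@Itv.num_sem R) (Itv.Real `[0%Z, 1%Z]) h.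
  by rewrite /= /Itv.num_sem /= ger0_real ?ltW //= in_itv /= h1 ltW.
have H : f (h *: y + (1 - h) *: x) <= h * f y + (1 - h) * f x.
  exact: (cf (Itv.mk hI) y x (mem_set I) (mem_set I)).
have E : h *: (y - x) + x = h *: y + (1 - h) *: x.
  by rewrite scalerBr scalerBl scale1r addrAC addrA.
by rewrite E -[_ *: _]/(h^-1 * _) ler_pdivrMl //; lra.
Unshelve. all: by end_near.
Qed.

(** A convex function whose gradient is Lipschitz grows at least like the squared
    variation of its gradient. Both first-order bounds are used at the point
    reached from [y] by a gradient step of length [L^-1] for the tilted function
    [fun z => f z - dot (grad f x) z], which is minimal at [x]. *)
Lemma convex_lower_grad (L : R) f x y : 0 < L -> lipschitz_gradient L f ->
  convex_function [set: convex_lmodType 'rV[R]_d] f ->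
  f x + dot (grad f x) (y - x) +
    (2 * L)^-1 * dot (grad f y - grad f x) (grad f y - grad f x) <= f y.
Proof.
move=> L0 lf cf; set v := grad f y - grad f x.
pose w := y - L^-1 *: v.
have := convex_lower x w (proj1 lf) cf.
have := lipschitz_gradient_upper y w L0 lf.
have -> : w - y = - (L^-1 *: v) by rewrite /w addrAC subrr add0r.
have -> : w - x = (y - x) - L^-1 *: v by rewrite /w addrAC.
have -> : grad f y = grad f x + v by rewrite /v addrC subrK.
clearbody v; rewrite !dotE.
set a := dot v v; set b := dot (grad f x) v.
have -> : L / 2 * - - (L^-1 * (L^-1 * a)) = (2 * L)^-1 * a by field; lra.
have -> : (2 * L)^-1 * a = L^-1 * a / 2 by field; lra.
by lra.
Qed.

(** A gradient step of length at most [L^-1] is nonexpansive: the two instances of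
    [convex_lower_grad] add up to the cocoercivity of the gradient. *)
Lemma gradient_step_nonexpansive (L eta : R) f x y :
  0 < L -> 0 <= eta -> eta * L <= 1 -> lipschitz_gradient L f ->
  convex_function [set: convex_lmodType 'rV[R]_d] f ->
  dot (x - y - eta *: (grad f x - grad f y)) (x - y - eta *: (grad f x - grad f y))
  <= dot (x - y) (x - y).
Proof.
move=> L0 eta0 etaL lf cf.
have := convex_lower_grad x y L0 lf cf.
have := convex_lower_grad y x L0 lf cf.
have <- : - (x - y) = y - x by rewrite opprB.
have <- : - (grad f x - grad f y) = grad f y - grad f x by rewrite opprB.
set u := x - y; set v := grad f x - grad f y.
have -> : grad f x = grad f y + v by rewrite /v addrC subrK.
clearbody u v; rewrite !dotE (dotC v u).
set a := dot v v; set b := dot u v; set e := dot u u; set m := dot _ u.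
have a0 : 0 <= a by exact: dot_ge0.
have -> : (2 * L)^-1 * a = L^-1 * a / 2 by field; lra.
rewrite opprK => h1 h2.
have h3 : L^-1 * a <= b by lra.
have h4 : eta * a <= L^-1 * a.
  by apply: ler_wpM2r => //; rewrite -[L^-1]mul1r ler_pdivlMr.
by nra.
Qed.

Lemma continuous_sq_dist x : continuous (fun y => dot (y - x) (y - x)).
Proof.
have c j : continuous (fun y : 'rV[R]_d => (y - x) 0 j).
  have -> : (fun y : 'rV[R]_d => (y - x) 0 j) =
            (fun y : 'rV[R]_d => y 0 j) - cst (x 0 j).
    by apply/funext => z; rewrite !mxE.
  move=> y; apply: continuousB; last exact: cst_continuous.
  exact: coord_continuous.
apply: continuous_big => [|j _ y]; first exact: add_continuous.
by apply: continuousM; exact: c.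
Qed.

Lemma continuous_grad (L : R) f j : 0 < L ->
  lipschitz_gradient L f -> continuous (fun x => grad f x 0 j).
Proof.
move=> L0 [_ lf] x.
apply/(@cvgrPdist_lt R R^o 'rV[R]_d (nbhs x) (nbhs_filter x)) => e e0.
have : \forall y \near x, dot (y - x) (y - x) < e ^+ 2 / L ^+ 2.
  apply: (cvgr_lt _ (@continuous_sq_dist x x)).
  by rewrite subrr dot0l divr_gt0 ?exprn_gt0.
apply: filterS => y; rewrite ltr_pdivlMr ?exprn_gt0 // mulrC => H.
rewrite -(@ltr_pXn2r _ 2) ?nnegrE // ?ltW //.
apply: le_lt_trans H; rewrite real_normK ?num_real //.
have := lf x y; move=> /(norm2_le_sq (mulr_ge0 (ltW L0) (norm2_ge0 _))).
rewrite exprMn norm2_sq -(opprB y x) dotNl dotNr opprK.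
apply: le_trans; rewrite /dot (bigD1 j) //= !mxE -expr2 lerDl.
by apply: sumr_ge0 => k _; rewrite -expr2 sqr_ge0.
Qed.

(** Self-bounding property of a smooth function with a minimum. *)
Lemma sq_grad_le_gap (L : R) f x xs : 0 < L -> lipschitz_gradient L f ->
  (forall y, f xs <= f y) -> dot (grad f x) (grad f x) <= 2 * L * (f x - f xs).
Proof.
move=> L0 lf fmin.
have := lipschitz_gradient_upper x (x - L^-1 *: grad f x) L0 lf.
have := fmin (x - L^-1 *: grad f x).
set w := f (_ - _) => h1.
have -> : x - L^-1 *: grad f x - x = - (L^-1 *: grad f x).
  by rewrite addrAC subrr add0r.
rewrite !dotE; set a := dot _ _ => h2.
have {h2} : 2^-1 * L^-1 * a <= f x - f xs.
  have : L / 2 * - - (L^-1 * (L^-1 * a)) = 2^-1 * L^-1 * a by field; lra.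
  by lra.
by rewrite -invfM ler_pdivrMl ?mulr_gt0 // mulrA.
Qed.

End ConvexAnalysis.

(** * The objective *)

Section Objective.
Context {R : realType} {d n : nat}.
Variables (f : 'I_n -> 'rV[R]_d -> R) (L : R).
Hypotheses (n0 : (0 < n)%N) (L0 : 0 < L).
Hypothesis lf : forall i, lipschitz_gradient L (f i).

Let objectiveE : objective f = n%:R^-1 \*: (\sum_i f i).
Proof. by apply/funext => x; rewrite /= fct_sumE. Qed.

Lemma differentiable_objective x : differentiable (objective f) x.
Proof.
rewrite objectiveE; apply: differentiableZ; apply: differentiable_sum => i.
exact: (proj1 (lf i)).
Qed.

Lemma grad_objective x : grad (objective f) x = n%:R^-1 *: \sum_i grad (f i) x.
Proof.
apply/rowP => j; rewrite !mxE summxE objectiveE deriveZ ?derive_sum //.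
- by congr (_ * _); apply: eq_bigr => i _; rewrite mxE.
- by move=> i; apply: diff_derivable; exact: (proj1 (lf i)).
- by apply: derivable_sum => i; apply: diff_derivable; exact: (proj1 (lf i)).
Qed.

Lemma lipschitz_gradient_objective : lipschitz_gradient L (objective f).
Proof.
split; first exact: differentiable_objective.
move=> x y; rewrite -(@ler_pXn2r _ 2) ?nnegrE ?norm2_ge0 //; last first.
  by rewrite mulr_ge0 ?norm2_ge0 // ltW.
rewrite exprMn !norm2_sq !grad_objective -scalerBr -sumrB.
apply: (le_trans (dot_mean _ n0)).
rewrite ler_pdivrMl ?ltr0n // mulr_natl -[X in _ *+ X](card_ord n) -sumr_const.
apply: ler_sum => i _; rewrite -norm2_sq -(norm2_sq (x - y)) -exprMn.
rewrite ler_pXn2r ?nnegrE ?norm2_ge0 //; first exact: (proj2 (lf i)).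
by rewrite mulr_ge0 ?norm2_ge0 // ltW.
Qed.

End Objective.

(** * Borel measurable random vectors *)

Section BorelVectors.
Context {R : realType} {d : nat}.

Lemma continuous_measurable_rV (g : 'rV[R]_d -> R) :
  continuous g -> measurable_fun [set: borel_rV R d] (g : borel_rV R d -> R).
Proof.
move=> /continuousP cg; apply: (measurability _ (RGenOInfty.measurableE R)).
move=> _ [_ [a ->] <-]; rewrite setTI; apply: sub_sigma_algebra.
exact/cg/interval_open.
Qed.

Context {dT : measure_display} {T : measurableType dT}.

(** A map into [R^d] is Borel as soon as its coordinates are: an open set is a
    countable union of boxes with rational corners. *)
Lemma measurable_fun_rV (U : T -> borel_rV R d) :
  (forall j, measurable_fun [set: T] (fun w => (U w : 'rV[R]_d) 0 j)) ->
  measurable_fun [set: T] U.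
Proof.
move=> mU; apply: (@measurability _ _ T (borel_rV R d) setT U (@open 'rV[R]_d) erefl).
move=> _ [W oW <-]; rewrite setTI.
pose box (q : 'rV[rat]_d * 'rV[rat]_d) : set 'rV[R]_d :=
  [set x | forall j, ratr (q.1 0 j) < x 0 j < ratr (q.2 0 j)].
have -> : U @^-1` W =
    \bigcup_(q in [set q | box q `<=` W]) (U @^-1` box q).
  apply/seteqP; split => [w Ww|w [q /= qW]]; last exact: qW.
  have /nbhs_ballP[e /= e0 eW] : nbhs (U w : 'rV[R]_d) W by exact: open_nbhs_nbhs.
  have ex j : exists q : rat * rat,
      [/\ (U w : 'rV[R]_d) 0 j - e < ratr q.1, ratr q.1 < (U w : 'rV[R]_d) 0 j,
          (U w : 'rV[R]_d) 0 j < ratr q.2 & ratr q.2 < (U w : 'rV[R]_d) 0 j + e].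
    have /rat_in_itvoo[a] : (U w : 'rV[R]_d) 0 j - e < (U w : 'rV[R]_d) 0 j.
      by rewrite ltrBlDr ltrDl.
    have /rat_in_itvoo[b] : (U w : 'rV[R]_d) 0 j < (U w : 'rV[R]_d) 0 j + e.
      by rewrite ltrDl.
    by rewrite !in_itv /= => /andP[? ?] /andP[? ?]; exists (a, b).
  have [q qP] := choice ex.
  exists (\row_j (q j).1, \row_j (q j).2).
    move=> x /= xq; apply: eW; split => // i j; rewrite ord1.
    have := xq j; rewrite !mxE /= => /andP[x1 x2].
    have [q1 q2 q3 q4] := qP j.
    by rewrite /ball /= ltr_norml; apply/andP; split; lra.
  by move=> j /=; rewrite !mxE; have [? ? ? ?] := qP j; apply/andP; split.
rewrite bigcup_mkcond; apply: countable_bigcupT_measurable => [|q].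
  exact: countableP.
case: ifP => // _.
have -> : U @^-1` box q = \big[setI/setT]_(j < d)
   ((fun w => (U w : 'rV[R]_d) 0 j) @^-1` `]ratr (q.1 0 j), ratr (q.2 0 j)[%classic).
  rewrite -bigcap_seq; apply/seteqP; split => w /=.
    by move=> H j _ /=; rewrite in_itv /=; exact: H.
  by move=> H j; have := H j; rewrite /= in_itv /=; apply; rewrite mem_index_enum.
apply: bigsetI_measurable => j _.
by rewrite -[X in measurable X]setTI; apply: mU => //; exact: measurable_itv.
Qed.

Lemma measurable_rV_coord (U : T -> borel_rV R d) j :
  measurable_fun [set: T] U ->
  measurable_fun [set: T] (fun w => (U w : 'rV[R]_d) 0 j).
Proof.
move=> mU; exact: (measurableT_comp
  (continuous_measurable_rV (@coord_continuous R 1 d 0 j)) mU).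
Qed.

Lemma measurable_rVD (U V : T -> 'rV[R]_d) :
  measurable_fun [set: T] (U : T -> borel_rV R d) ->
  measurable_fun [set: T] (V : T -> borel_rV R d) ->
  measurable_fun [set: T] (fun w => U w + V w : borel_rV R d).
Proof.
move=> mU mV; apply: measurable_fun_rV => j; under eq_fun do rewrite mxE.
by apply: measurable_funD; exact: measurable_rV_coord.
Qed.

Lemma measurable_rVZ (c : R) (U : T -> 'rV[R]_d) :
  measurable_fun [set: T] (U : T -> borel_rV R d) ->
  measurable_fun [set: T] (fun w => c *: U w : borel_rV R d).
Proof.
move=> mU; apply: measurable_fun_rV => j; under eq_fun do rewrite mxE.
apply: measurable_funM; first exact: measurable_cst.
exact: measurable_rV_coord.
Qed.

Lemma measurable_rVB (U V : T -> 'rV[R]_d) :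
  measurable_fun [set: T] (U : T -> borel_rV R d) ->
  measurable_fun [set: T] (V : T -> borel_rV R d) ->
  measurable_fun [set: T] (fun w => U w - V w : borel_rV R d).
Proof.
move=> mU mV; apply: measurable_rVD => //.
by under eq_fun do rewrite -scaleN1r; exact: measurable_rVZ.
Qed.

Lemma measurable_rV_sum (I : Type) (s : seq I) (U : I -> T -> 'rV[R]_d) :
  (forall i, measurable_fun [set: T] (U i : T -> borel_rV R d)) ->
  measurable_fun [set: T] (fun w => \sum_(i <- s) U i w : borel_rV R d).
Proof.
move=> mU; elim: s => [|i s IH].
  by under eq_fun do rewrite big_nil; exact: measurable_cst.
by under eq_fun do rewrite big_cons; exact: measurable_rVD.
Qed.

Lemma measurable_dot (U : T -> 'rV[R]_d) :
  measurable_fun [set: T] (U : T -> borel_rV R d) ->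
  measurable_fun [set: T] (fun w => dot (U w) (U w)).
Proof.
move=> mU; apply: measurable_sum => j.
by apply: measurable_funM; exact: measurable_rV_coord.
Qed.

Lemma measurable_grad (L : R) (f : 'rV[R]_d -> R) (U : T -> 'rV[R]_d) :
  0 < L -> lipschitz_gradient L f ->
  measurable_fun [set: T] (U : T -> borel_rV R d) ->
  measurable_fun [set: T] (fun w => grad f (U w) : borel_rV R d).
Proof.
move=> L0 lf mU; apply: measurable_fun_rV => j.
have mg := continuous_measurable_rV (continuous_grad (j := j) L0 lf).
exact: (measurableT_comp mg mU).
Qed.

End BorelVectors.

(** * Independence of the past and freezing *)

Section Freezing.
Context {R : realType} {dO : measure_display} {Omega : measurableType dO}.
Context {P : probability Omega R} {I : finType} {dX : measure_display}.
Context {X : I -> measurableType dX} {Y : forall k : I, {RV P >-> X k}}.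
Implicit Types (K : {set I}) (k : I).

(** The events determined by one measurable condition on each [Y k], [k \in K].
    They form a pi-system, which generates the sigma-algebra of the [Y k]. *)
Definition cylinders K : set (set Omega) :=
  [set S | exists2 A : forall k, set (X k), (forall k, measurable (A k)) &
     S = \bigcap_(k in [set` K]) (Y k @^-1` A k)].

(** [Omega] with the sigma-algebra generated by the [Y k], [k \in K]. *)
Definition sigma_of K := g_sigma_algebraType (cylinders K).

Lemma setI_closed_cylinders K : setI_closed (cylinders K).
Proof.
move=> _ _ [A mA ->] [B mB ->]; exists (fun k => A k `&` B k).
  by move=> k; exact: measurableI.
by rewrite -bigcapI.
Qed.

Lemma cylinders_measurable K : cylinders K `<=` measurable.
Proof.
move=> _ [A mA ->]; apply: fin_bigcap_measurable => //= k _.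
exact: measurable_funPTI.
Qed.

Lemma setT_cylinders K : cylinders K setT.
Proof.
by exists (fun=> setT) => //; apply/seteqP; split.
Qed.

Lemma measurable_sigma_of K k : k \in K ->
  measurable_fun [set: sigma_of K] (Y k : sigma_of K -> X k).
Proof.
move=> kK _ B mB; rewrite setTI; apply: sub_sigma_algebra.
exists (dfwith (fun j => [set: X j]) k B).
  by move=> j; case: dfwithP.
apply/seteqP; split => [w Bw j _ /=|w /(_ k kK) /=].
  by case: dfwithP.
by rewrite dfwithin.
Qed.

Lemma sub_sigma_of K K' dT (T : measurableType dT) (U : Omega -> T) :
  K \subset K' -> measurable_fun [set: sigma_of K] (U : sigma_of K -> T) ->
  measurable_fun [set: sigma_of K'] (U : sigma_of K' -> T).
Proof.
move=> KK' mU _ B mB; have := mU measurableT B mB.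
rewrite !setTI; apply: smallest_sub; first exact: smallest_sigma_algebra.
move=> _ [A mA ->]; apply: sub_sigma_algebra.
exists (fun k => if k \in K then A k else setT).
  by move=> k; case: ifP.
apply/seteqP; split => [w Aw k _ /=|w Aw k kK].
  by case: ifP => // kK; exact: Aw.
by have := Aw k (fintype.subsetP KK' k kK); rewrite /= [k \in K]kK.
Qed.

Lemma sigma_of_measurable K dT (T : measurableType dT) (U : Omega -> T) :
  measurable_fun [set: sigma_of K] (U : sigma_of K -> T) ->
  measurable_fun [set: Omega] U.
Proof.
move=> mU _ B mB; have := mU measurableT B mB.
rewrite !setTI; apply: smallest_sub; first exact: sigma_algebra_measurable.
exact: cylinders_measurable.
Qed.

Hypothesis indepY : mutually_independent P (fun k => Y k : Omega -> X k).

(** Independence passes from the pi-system of cylinders to the sigma-algebra that it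
    generates, by uniqueness of finite measures. *)
Lemma indep_sigma_of K k (E : set Omega) (B : set (X k)) :
  k \notin K -> <<s cylinders K >> E -> measurable B ->
  (P (E `&` Y k @^-1` B) = P E * P (Y k @^-1` B))%E.
Proof.
move=> kK sE mB.
have mYB : measurable (Y k @^-1` B) by exact: measurable_funPTI.
have PB0 : (0 <= fine (P (Y k @^-1` B)))%R by rewrite fine_ge0.
rewrite -[in RHS](@fineK _ (P (Y k @^-1` B))) ?fin_num_measure // muleC.
pose c := NngNum PB0.
apply: (g_sigma_algebra_measure_unique (cylinders K) (@cylinders_measurable K)
   (fun=> setT) _ _ (mrestr P mYB) (mscale c P)) => //.
- by move=> _; exact: setT_cylinders.
- by rewrite bigcup_const.
- exact: setI_closed_cylinders.
- move=> _ [A mA ->].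
  set S := \bigcap_(j in _) _.
  change (P (S `&` Y k @^-1` B) = ((fine (P (Y k @^-1` B)))%:E * P S)%E).
  rewrite fineK ?fin_num_measure // /S {S}.
  have -> : \bigcap_(j in [set` K]) (Y j @^-1` A j) `&` Y k @^-1` B =
     \bigcap_(j in [set` (k |: K)%SET]) (Y j @^-1` dfwith A k B j).
    apply/seteqP; split => w.
      move=> [Aw Bw] j /=; rewrite !inE => /orP[/eqP ->|jK].
        by rewrite dfwithin.
      rewrite dfwithout; first exact: Aw.
      by apply: contraNneq kK => ->.
    move=> Aw; split => [j /= jK|].
      have := Aw j; rewrite /= !inE jK orbT dfwithout; first by apply.
      by apply: contraNneq kK => ->.
    by have := Aw k; rewrite /= !inE eqxx dfwithin; apply.
  rewrite indepY; last by move=> j; case: dfwithP.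
  rewrite indepY // big_setU1 //= dfwithin; congr (_ * _)%E.
  apply: eq_bigr => j jK; rewrite dfwithout //.
  by apply: contraNneq kK => ->.
- by move=> _; rewrite ltey_eq fin_num_measure.
Qed.

(** Freezing: integrating a function of the past and of an independent variable
    amounts to integrating first over a fresh copy of that variable. The
    identity of [Omega], seen as a map into [sigma_of K], is the universal
    past-measurable variable. *)
Lemma freezing K k (H : sigma_of K * X k -> \bar R) : k \notin K ->
  measurable_fun setT H -> (forall z, 0 <= H z)%E ->
  (\int[P]_w H (w, Y k w) = \int[P]_w \int[P]_v H (w, Y k v))%E.
Proof.
move=> kK mH H0.
have mid : measurable_fun [set: Omega] (id : Omega -> sigma_of K).
  apply: (@sigma_of_measurable K _ (sigma_of K)); exact: measurable_id.
pose idm : {mfun Omega >-> sigma_of K} := HB.pack (id : Omega -> sigma_of K)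
   (isMeasurableFun.Build _ _ _ _ _ mid).
have mpr : measurable_fun [set: Omega] (fun w => (w : sigma_of K, Y k w)).
  by apply: measurable_fun_pair => //; exact: measurable_funP.
pose prm : {mfun Omega >-> (sigma_of K * X k)%type} :=
  HB.pack (fun w => (w : sigma_of K, Y k w))
   (isMeasurableFun.Build _ _ _ _ _ mpr).
transitivity (\int[distribution P prm]_z H z)%E.
  by rewrite ge0_integral_distribution.
transitivity (\int[distribution P idm \x distribution P (Y k)]_z H z)%E.
  apply: eq_measure_integral => A mA _; apply/esym.
  apply: product_measure_unique => //.
  move=> B C mB mC; rewrite /distribution /pushforward /=.
  by rewrite -(indep_sigma_of kK).
rewrite fubini_tonelli1 // /fubini_F ge0_integral_distribution //.
- apply: eq_integral => w _ /=; rewrite ge0_integral_distribution //.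
  by apply: measurableT_comp mH _; exact: pair1_measurable.
- exact: measurable_fun_fubini_tonelli_F.
- by move=> w; exact: integral_ge0.
Qed.

Lemma measurable_freezing K k (H : sigma_of K * X k -> \bar R) :
  measurable_fun setT H -> (forall z, 0 <= H z)%E ->
  measurable_fun [set: sigma_of K] (fun w => \int[P]_v H (w, Y k v))%E.
Proof.
move=> mH H0.
have -> : (fun w : sigma_of K => \int[P]_v H (w, Y k v))%E =
          fubini_F (distribution P (Y k)) H.
  apply/funext => w; rewrite /fubini_F ge0_integral_distribution //.
  by apply: measurableT_comp mH _; exact: pair1_measurable.
exact: measurable_fun_fubini_tonelli_F.
Qed.

End Freezing.

(** * Centered noise *)

Section Noise.
Context {R : realType} {d : nat} {dO : measure_display} {Omega : measurableType dO}.
Context {P : probability Omega R}.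

Lemma integral_probability_cst (r : R) : (\int[P]_v r%:E = r%:E)%E.
Proof. by have := expectation_cst P r; rewrite unlock. Qed.

(** Subtracting [c] times a centered noise of variance at most [s] adds at most
    [c ^+ 2 * s] to the expected squared norm of a deterministic vector. *)
Lemma sq_dist_centered (Q : Omega -> 'rV[R]_d) (m a : 'rV[R]_d) (c s : R) :
  measurable_fun [set: Omega] (Q : Omega -> borel_rV R d) ->
  (forall j, \int[P]_v (Q v 0 j)%:E = (m 0 j)%:E)%E ->
  (\int[P]_v (dot (Q v - m) (Q v - m))%:E <= s%:E)%E ->
  (\int[P]_v (dot (a - c *: (Q v - m)) (a - c *: (Q v - m)))%:E
    <= (dot a a + c ^+ 2 * s)%:E)%E.
Proof.
move=> mQ EQ VQ; pose N v := Q v - m.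
have mN : measurable_fun [set: Omega] (N : Omega -> borel_rV R d).
  by apply: measurable_rVB => //; exact: measurable_cst.
have mD := measurable_dot mN.
have iD : P.-integrable [set: Omega] (fun v => (dot (N v) (N v))%:E).
  apply/integrableP; split; first exact/measurable_EFinP.
  apply: le_lt_trans (ltry s); apply: le_trans VQ.
  rewrite le_eqVlt; apply/orP; left; apply/eqP; apply: eq_integral => v _.
  by rewrite gee0_abs // lee_fin dot_ge0.
have iC (r : R) : P.-integrable [set: Omega] (fun=> r%:E).
  by apply: (finite_measure_integrable_cst P r).
(* The coordinates of the noise are integrable, since |y| <= 1 + y ^+ 2. *)
have iN j : P.-integrable [set: Omega] (fun v => (N v 0 j)%:E).
  apply: (@le_integrable _ _ _ _ _ _ _ (fun v => 1%:E + (dot (N v) (N v))%:E)%E) => //.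
  - by apply/measurable_EFinP; exact: measurable_rV_coord.
  - move=> v _; rewrite -EFinD !abse_EFin lee_fin.
    rewrite [leRHS]ger0_norm ?addr_ge0 ?dot_ge0 //.
    have : N v 0 j ^+ 2 <= dot (N v) (N v).
      rewrite /dot (bigD1 j) //= -expr2 lerDl.
      by apply: sumr_ge0 => k _; rewrite -expr2 sqr_ge0.
    rewrite ler_norml; set x := N v 0 j; nra.
  - exact: integrableD.
have E0 j : (\int[P]_v (N v 0 j)%:E = 0)%E.
  have : (\int[P]_v ((N v 0 j)%:E + (m 0 j)%:E) = (m 0 j)%:E)%E.
    rewrite -[RHS](EQ j); apply: eq_integral => v _.
    by rewrite -EFinD /N !mxE subrK.
  rewrite integralD // integral_probability_cst.
  rewrite -(fineK (integrable_fin_num measurableT (iN j))) // -EFinD.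
  by case=> h; congr EFin; lra.
have -> : (\int[P]_v (dot (a - c *: (Q v - m)) (a - c *: (Q v - m)))%:E =
  \int[P]_v (((dot a a)%:E + \sum_(j < d) (- 2 * c * a 0 j)%:E * (N v 0 j)%:E)
            + (c ^+ 2)%:E * (dot (N v) (N v))%:E))%E.
  apply: eq_integral => v _; rewrite -/(N v); move: (N v) => y.
  under eq_bigr do rewrite -EFinM.
  rewrite sumEFin -EFinM -!EFinD; congr EFin.
  have -> : \sum_(j < d) (- 2 * c * a 0 j) * y 0 j = - 2 * c * dot a y.
    by rewrite mulr_sumr; apply: eq_bigr => j _; rewrite mulrA.
  by rewrite !dotE (dotC y a); ring.
have iS : P.-integrable [set: Omega]
    (fun v => \sum_(j < d) (- 2 * c * a 0 j)%:E * (N v 0 j)%:E)%E.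
  by apply: integrable_sum => // j _; exact: integrableZl.
rewrite integralD //; [|exact: integrableD|exact: integrableZl].
rewrite integralD // integral_probability_cst integralZl //.
rewrite integral_sum //; last by move=> j; exact: integrableZl.
rewrite big1 ?adde0; last by move=> j _; rewrite integralZl // E0 mule0.
rewrite EFinD leeD2l // [leRHS]EFinM; apply: lee_wpmul2l => //.
by rewrite lee_fin sqr_ge0.
Qed.

End Noise.

(** * Integrals of nonnegative functions *)

Section NonnegativeIntegrals.
Context {R : realType} {dO : measure_display} {Omega : measurableType dO}.
Variable mu : {measure set Omega -> \bar R}.
Implicit Types a b : Omega -> R.

Lemma ge0_integralD_EFin a b :
  measurable_fun setT a -> measurable_fun setT b ->
  (forall w, 0 <= a w) -> (forall w, 0 <= b w) ->
  (\int[mu]_w (a w + b w)%:E = \int[mu]_w (a w)%:E + \int[mu]_w (b w)%:E)%E.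
Proof.
move=> ma mb a0 b0; rewrite -ge0_integralD //.
- by move=> w _; rewrite lee_fin.
- exact/measurable_EFinP.
- by move=> w _; rewrite lee_fin.
- exact/measurable_EFinP.
Qed.

Lemma ge0_integralZ_EFin (c : R) a :
  measurable_fun setT a -> (forall w, 0 <= a w) -> 0 <= c ->
  (\int[mu]_w (c * a w)%:E = c%:E * \int[mu]_w (a w)%:E)%E.
Proof.
move=> ma a0 c0; rewrite -ge0_integralZl_EFin //.
- by move=> w _; rewrite lee_fin.
- exact/measurable_EFinP.
Qed.

Lemma ge0_integral_sum_EFin (I : Type) (s : seq I) (a : I -> Omega -> R) :
  (forall i, measurable_fun setT (a i)) -> (forall i w, 0 <= a i w) ->
  (\int[mu]_w (\sum_(i <- s) a i w)%:E = \sum_(i <- s) \int[mu]_w (a i w)%:E)%E.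
Proof.
move=> ma a0; under eq_integral do rewrite -sumEFin.
rewrite ge0_integral_sum //.
- by move=> i; exact/measurable_EFinP.
- by move=> i w _; rewrite lee_fin.
Qed.

Lemma ge0_le_integral_EFin a b :
  measurable_fun setT a -> measurable_fun setT b ->
  (forall w, 0 <= a w) -> (forall w, a w <= b w) ->
  (\int[mu]_w (a w)%:E <= \int[mu]_w (b w)%:E)%E.
Proof.
move=> ma mb a0 ab; apply: ge0_le_integral => //.
- by move=> w _; rewrite lee_fin.
- exact/measurable_EFinP.
- exact/measurable_EFinP.
- by move=> w _; rewrite lee_fin.
Qed.

End NonnegativeIntegrals.

(** * Noise of the stochastic oracle *)

Section ConditionalNoise.
Context {R : realType} {d : nat} {dO : measure_display} {Omega : measurableType dO}.
Context {P : probability Omega R} {I : finType} {dX : measure_display}.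
Context {X : I -> measurableType dX} {Y : forall k : I, {RV P >-> X k}}.
Hypothesis indepY : mutually_independent P (fun k => Y k : Omega -> X k).

(** Extension of [sq_dist_centered] to a vector [V] and a query point [U] that are
    determined by variables [Y j], [j \in K], independent of the variable [Y k] that
    drives the oracle. *)
Lemma sq_dist_oracle (K : {set I}) (k : I) (G : 'rV[R]_d -> X k -> 'rV[R]_d)
    (m : 'rV[R]_d -> 'rV[R]_d) (s c : R) (U V : Omega -> 'rV[R]_d) :
  k \notin K -> borel_function G ->
  (forall x j, \int[P]_w (G x (Y k w) 0 j)%:E = (m x 0 j)%:E)%E ->
  (forall x, \int[P]_w (dot (G x (Y k w) - m x) (G x (Y k w) - m x))%:E <= s%:E)%E ->
  measurable_fun [set: sigma_of (Y := Y) K] (U : sigma_of (Y := Y) K -> borel_rV R d) ->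
  measurable_fun [set: sigma_of (Y := Y) K] (V : sigma_of (Y := Y) K -> borel_rV R d) ->
  measurable_fun [set: sigma_of (Y := Y) K] (fun w => m (U w) : borel_rV R d) ->
  0 <= s ->
  (\int[P]_w (dot (V w - c *: (G (U w) (Y k w) - m (U w)))
                  (V w - c *: (G (U w) (Y k w) - m (U w))))%:E
   <= \int[P]_w (dot (V w) (V w))%:E + (c ^+ 2 * s)%:E)%E.
Proof.
move=> kK; rewrite /borel_function => mG EG VG mU mV mm s0.
pose N (z : sigma_of (Y := Y) K * X k) : 'rV[R]_d :=
  V z.1 - c *: (G (U z.1) z.2 - m (U z.1)).
have mN : measurable_fun setT (N : sigma_of (Y := Y) K * X k -> borel_rV R d).
  apply: measurable_rVB; first exact: (measurableT_comp mV).
  apply: measurable_rVZ; apply: measurable_rVB.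
    have mp : measurable_fun setT
        (fun z : sigma_of (Y := Y) K * X k => (U z.1 : borel_rV R d, z.2)).
      by apply: measurable_fun_pair => //; exact: (measurableT_comp mU).
    exact: (measurableT_comp mG mp).
  exact: (measurableT_comp mm).
have mH : measurable_fun setT (fun z => (dot (N z) (N z))%:E).
  by apply/measurable_EFinP; exact: measurable_dot.
rewrite [leLHS](_ : _ = \int[P]_w (dot (N (w, Y k w)) (N (w, Y k w)))%:E)%E //.
have H0 z : (0 <= (dot (N z) (N z))%:E)%E by rewrite lee_fin dot_ge0.
rewrite (freezing indepY kK mH H0).
have mF := sigma_of_measurable (measurable_freezing mH H0).
have mV' : measurable_fun [set: Omega] (V : Omega -> borel_rV R d).
  exact: sigma_of_measurable mV.
have mVV := measurable_dot mV'.
have -> : (\int[P]_w (dot (V w) (V w))%:E + (c ^+ 2 * s)%:E =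
           \int[P]_w ((dot (V w) (V w))%:E + (c ^+ 2 * s)%:E))%E.
  rewrite ge0_integralD //.
  - by rewrite integral_probability_cst.
  - by move=> w _; rewrite lee_fin dot_ge0.
  - exact/measurable_EFinP.
  - by move=> w _; rewrite lee_fin mulr_ge0 ?sqr_ge0.
apply: ge0_le_integral => //.
- by move=> w _; apply: integral_ge0 => v _; rewrite lee_fin dot_ge0.
- by apply: emeasurable_funD => //; exact/measurable_EFinP.
- move=> w _; rewrite -EFinD.
  apply: (@sq_dist_centered _ _ _ _ _ (fun v => G (U w) (Y k v))
    (m (U w)) (V w) c s) => //.
  have mp : measurable_fun setT (fun v => (U w : borel_rV R d, Y k v)).
    by apply: measurable_fun_pair => //; exact: measurable_cst.
  exact: (measurableT_comp mG mp).
Qed.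

End ConditionalNoise.

(** * One step with exact gradients *)

Section OneStep.
Context {R : realType} {d n : nat}.
Variables (f : 'I_n -> 'rV[R]_d -> R) (L : R).
Hypotheses (n0 : (0 < n)%N) (L0 : 0 < L).
Hypothesis lf : forall i, lipschitz_gradient L (f i).
Hypothesis cf : forall i, convex_function [set: convex_lmodType 'rV[R]_d] (f i).

Let n0R : 0 < n%:R :> R. Proof. by rewrite ltr0n. Qed.
Let nne : n%:R != 0 :> R. Proof. by rewrite lt0r_neq0. Qed.

(** One step from [u] along the mean [h] of the gradients taken at the points [y i]:
    the squared distance to a minimizer decreases by [eta] times the optimality gap
    of [u], up to the dispersion of the [y i] around [u]. *)
Lemma averaged_step (eta : R) (y : 'I_n -> 'rV[R]_d) (u xs : 'rV[R]_d)
    (h := n%:R^-1 *: \sum_i grad (f i) (y i)) :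
  0 < eta -> 4 * L * eta <= 1 -> (forall z, objective f xs <= objective f z) ->
  dot (u - xs - eta *: h) (u - xs - eta *: h)
    + eta * (objective f u - objective f xs)
  <= dot (u - xs) (u - xs)
    + 3 / 2 * eta * L * (n%:R^-1 * \sum_i dot (y i - u) (y i - u)).
Proof.
move=> eta0 etaL fmin; set W := _^-1 * _; set gap := objective f u - _.
have gap0 : 0 <= gap by rewrite subr_ge0.
have W0 : 0 <= W.
  by rewrite mulr_ge0 ?invr_ge0 ?ler0n //; apply: sumr_ge0 => i _; exact: dot_ge0.
have lF := lipschitz_gradient_objective n0 L0 lf.
have h1 : gap - L / 2 * W <= dot h (u - xs).
  rewrite dotZl dot_suml /gap /objective -mulrBr -sumrB /W mulrCA -mulrBr.
  rewrite ler_wpM2l ?invr_ge0 ?ler0n // mulr_sumr -sumrB; apply: ler_sum => i _.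
  have := lipschitz_gradient_upper (y i) u L0 (lf i).
  have := convex_lower (y i) xs (proj1 (lf i)) (@cf i).
  rewrite -(opprB (y i) u) !dotE; lra.
have h2 : dot h h <= 2 * L ^+ 2 * W + 4 * L * gap.
  have g1 := sq_grad_le_gap u L0 lF fmin.
  have g2 : dot (h - grad (objective f) u) (h - grad (objective f) u) <= L ^+ 2 * W.
    rewrite (grad_objective lf) /h -scalerBr -sumrB.
    apply: (le_trans (dot_mean _ n0)).
    rewrite /W mulrCA ler_wpM2l ?invr_ge0 ?ler0n // mulr_sumr.
    apply: ler_sum => i _; rewrite -(norm2_sq (y i - u)) -exprMn.
    apply: norm2_le_sq; first by rewrite mulr_ge0 ?norm2_ge0 // ltW.
    exact: (proj2 (lf i)).
  have := dot_young (h - grad (objective f) u) (grad (objective f) u) ltr01.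
  have -> : dot h h = dot (h - grad (objective f) u + grad (objective f) u)
                          (h - grad (objective f) u + grad (objective f) u).
    by rewrite subrK.
  move: g1 g2; rewrite -/gap; set v := grad (objective f) u.
  move: (h - v) => k; rewrite !dotE (dotC v k) invr1; lra.
have -> : dot (u - xs - eta *: h) (u - xs - eta *: h) =
    dot (u - xs) (u - xs) - 2 * eta * dot h (u - xs) + eta ^+ 2 * dot h h.
  by move: (u - xs) => k; move: h {h1 h2} => h; rewrite !dotE (dotC k h); ring.
move: h1 h2; move: (dot h _) (dot h h) => p q h1 h2.
have h3 : eta * (gap - L / 2 * W) <= eta * p by rewrite ler_wpM2l // ltW.
have h4 : eta ^+ 2 * q <= eta ^+ 2 * (2 * L ^+ 2 * W + 4 * L * gap).
  by rewrite ler_wpM2l // sqr_ge0.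
have h5 : eta * (4 * L * eta) * gap <= eta * gap.
  by rewrite ler_wpM2r // ler_piMr // ltW.
have h6 : eta * L * (4 * L * eta) * W <= eta * L * W.
  by rewrite ler_wpM2r // ler_piMr // mulr_ge0 ?ltW.
nra.
Qed.

(** The dispersion of the local iterates around [u] grows slowly: compare each of
    them with the gradient step of the objective from [u], using that a local
    gradient step is nonexpansive. Heterogeneity is only measured at [u]. The
    parameter [tau] is that of Young's inequality. *)
Lemma local_steps_dispersion (eta zeta tau : R) (y : 'I_n -> 'rV[R]_d) (u : 'rV[R]_d) :
  0 < eta -> eta * L <= 1 -> 0 < tau ->
  n%:R^-1 * \sum_i norm2 (grad (f i) u - grad (objective f) u) ^+ 2 <= zeta ^+ 2 ->
  \sum_i dot (y i - eta *: grad (f i) (y i) - (u - eta *: grad (objective f) u))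
             (y i - eta *: grad (f i) (y i) - (u - eta *: grad (objective f) u))
  <= (1 + tau^-1) * (\sum_i dot (y i - u) (y i - u))
     + n%:R * ((1 + tau) * eta ^+ 2 * zeta ^+ 2).
Proof.
move=> eta0 etaL tau0; rewrite ler_pdivrMl // => hz.
have hz' : \sum_i (1 + tau) * eta ^+ 2 *
    norm2 (grad (f i) u - grad (objective f) u) ^+ 2
    <= n%:R * ((1 + tau) * eta ^+ 2 * zeta ^+ 2).
  rewrite -mulr_sumr [leRHS]mulrCA ler_wpM2l // mulr_ge0 ?sqr_ge0 //; lra.
apply: le_trans (lerD (lexx _) hz'); rewrite mulr_sumr -big_split /=.
apply: ler_sum => i _; rewrite norm2_sq.
have := gradient_step_nonexpansive (y i) u L0 (ltW eta0) etaL (lf i) (@cf i).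
set e := dot (y i - u) (y i - u).
set a := y i - u - _; set b := grad (f i) u - _.
have -> : y i - eta *: grad (f i) (y i) - (u - eta *: grad (objective f) u) =
   a - eta *: b.
  by rewrite /a /b; apply/rowP => j; rewrite !mxE; ring.
move=> ae; clearbody a b.
have := dot_young (- a) (eta *: b) tau0; rewrite !dotE (dotC b a) => h.
have h2 : (1 + tau^-1) * dot a a <= (1 + tau^-1) * e.
  by rewrite ler_wpM2l // addr_ge0 // invr_ge0 ltW.
nra.
Qed.

End OneStep.

(** * Recursions for the iterates of local SGD *)

(** An elementary substitute for the bound by [expR 1]; the induction is on [m], for
    the stronger bound 1 + m / k + (m / k)^2. *)
Lemma exp_succ_inv_le3 (R : realType) (m k : nat) : (m <= k)%N ->
  (1 + k%:R^-1) ^+ m <= 3 :> R.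
Proof.
move=> mk; have [->|k0] := posnP k.
  by move: mk; rewrite invr0 addr0 expr1n => _; lra.
have k0R : 0 < k%:R :> R by rewrite ltr0n.
suff H : (1 + k%:R^-1) ^+ m <= 1 + m%:R / k%:R + (m%:R / k%:R) ^+ 2 :> R.
  have a1 : m%:R / k%:R <= 1 :> R by rewrite ler_pdivrMr // mul1r ler_nat.
  have a0 : 0 <= m%:R / k%:R :> R by rewrite divr_ge0 ?ler0n.
  by apply: le_trans H _; nra.
elim: m mk => [_|m IH mk]; first by rewrite expr0 mul0r expr0n /= !addr0.
have {}IH := IH (ltnW mk); rewrite exprSr.
have a1 : m%:R / k%:R <= 1 :> R by rewrite ler_pdivrMr // mul1r ler_nat ltnW.
have a0 : 0 <= m%:R / k%:R :> R by rewrite divr_ge0 ?ler0n.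
have d0 : 0 < k%:R^-1 :> R by rewrite invr_gt0.
have q0 : 0 <= 1 + k%:R^-1 :> R by rewrite addr_ge0 // ltW.
apply: (le_trans (ler_wpM2r q0 IH)).
have -> : m.+1%:R / k%:R = m%:R / k%:R + k%:R^-1 :> R.
  by rewrite -natr1 mulrDl mul1r.
set a := _ / _ in a0 a1 *; set e := _^-1 in d0 *.
have h : 0 <= a * e * (1 - a) by rewrite !mulr_ge0 ?subr_ge0 // ltW.
have := sqr_ge0 e; nra.
Qed.

Section LocalSGD.
Context {R : realType} {n d tau T : nat}.
Variables (L sigma zeta eta : R) (f : 'I_n -> 'rV[R]_d -> R).
Context {dO : measure_display} {Omega : measurableType dO}.
Context {P : probability Omega R} {dX : measure_display}.
Context {X : 'I_n -> measurableType dX}.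
Variables (G : forall i : 'I_n, 'rV[R]_d -> X i -> 'rV[R]_d).
Variables (xi : forall i : 'I_n, nat -> {RV P >-> X i}).
Variables (x0 xs : 'rV[R]_d) (x : nat -> 'I_n -> Omega -> 'rV[R]_d).

Let F := objective f.
(** The random variables of the oracle, as a finite family. *)
Let Y (k : ('I_n * 'I_T)%type) : {RV P >-> X k.1} := xi k.1 k.2.

Hypotheses (n0 : (0 < n)%N) (tau2 : (2 <= tau)%N) (L0 : 0 < L) (eta0 : 0 < eta).
Hypothesis sgd : local_sgd tau T eta G xi x0 x.

(** The stochastic gradient used by worker [i] at time [t]. *)
Let g t i w := @G i (x t i w) (xi i t w).

Let nne : n%:R != 0 :> R. Proof. by rewrite pnatr_eq0 -lt0n. Qed.

Let mean_const (v : 'rV[R]_d) : n%:R^-1 *: \sum_(j < n) v = v.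
Proof.
by rewrite sumr_const card_ord -[v *+ n]scaler_nat scalerA mulVf ?scale1r.
Qed.

Let sgd0 i w : x 0%N i w = x0.
Proof. by have := proj1 sgd; apply. Qed.

Let sgdS t i w : (t < T)%N -> x t.+1 i w =
  if (tau %| t.+1)%N
  then worker_mean (x (t.+1 - tau)%N) w
       - (eta / n%:R) *: \sum_(j < n) \sum_(k < tau) g (t - k)%N j w
  else x t i w - eta *: g t i w.
Proof. by have := proj2 sgd; apply. Qed.

(** The local phase that starts at a communication time [s]. *)
Lemma local_steps s k j w : (s + k <= T)%N -> (k < tau)%N -> (tau %| s)%N ->
  x (s + k)%N j w = x s j w - eta *: \sum_(l < k) g (s + l)%N j w.
Proof.
move=> + + ds; elim: k => [|k IH] skT kt.
  by rewrite addn0 big_ord0 scaler0 subr0.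
have {}IH : x (s + k)%N j w = x s j w - eta *: \sum_(l < k) g (s + l)%N j w.
  by apply: IH; lia.
rewrite addnS sgdS; last by lia.
have -> : (tau %| (s + k).+1)%N = false.
  by rewrite -addnS dvdn_addr // gtnNdvd.
by rewrite {1}IH big_ord_recr /= scalerDr opprD addrA.
Qed.

(** Communication replaces the local iterates by the mean of the local steps. *)
Lemma local_sgd_step t i w : (t < T)%N ->
  x t.+1 i w = if (tau %| t.+1)%N
    then n%:R^-1 *: \sum_j (x t j w - eta *: g t j w)
    else x t i w - eta *: g t i w.
Proof.
move=> tT; rewrite sgdS //; case: ifP => // dt.
have [m tE] := dvdnP dt; have m0 : (0 < m)%N by case: m tE.
have sE : (t.+1 - tau)%N = (m.-1 * tau)%N.
  by rewrite tE; case: m m0 {tE} => // m _; rewrite mulSn; lia.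
have tE' : t = ((t.+1 - tau) + tau.-1)%N.
  by rewrite sE; case: m m0 tE {sE} => // m _; rewrite mulSn; lia.
have ds : (tau %| t.+1 - tau)%N by rewrite sE dvdn_mull.
rewrite /worker_mean [eta / _]mulrC -scalerA -scalerBr; congr (_ *: _).
rewrite scaler_sumr -sumrB; apply: eq_bigr => j _.
have -> : x t j w = x (t.+1 - tau)%N j w
    - eta *: \sum_(l < tau.-1) g (t.+1 - tau + l)%N j w.
  by rewrite {1}tE'; apply: local_steps => //; lia.
rewrite -addrA -opprD -scalerDr; congr (_ - _ *: _).
have tauE : tau = tau.-1.+1 by lia.
have split_last (h : nat -> 'rV[R]_d) :
    \sum_(k < tau) h k = \sum_(k < tau.-1) h k + h tau.-1.
  by rewrite tauE big_ord_recr.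
rewrite (reindex_inj rev_ord_inj) /=.
have -> : \sum_(k < tau) @G j (x (t - (tau - k.+1))%N j w) (xi j (t - (tau - k.+1)) w)
    = \sum_(k < tau) g (t.+1 - tau + k)%N j w.
  apply: eq_bigr => k _; rewrite /g.
  by have -> : (t - (tau - k.+1) = t.+1 - tau + k)%N by have := ltn_ord k; lia.
rewrite (split_last (fun k => g (t.+1 - tau + k)%N j w)); congr (_ + _).
by rewrite -tE'.
Qed.

Let xb t w := worker_mean (x t) w.

(** The mean iterate moves in the same way whether or not the workers communicate. *)
Lemma worker_mean_step t w : (t < T)%N ->
  xb t.+1 w = xb t w - (eta / n%:R) *: \sum_i g t i w.
Proof.
move=> tT; have E : xb t.+1 w = n%:R^-1 *: \sum_j (x t j w - eta *: g t j w).
  rewrite /xb /worker_mean; case dt : (tau %| t.+1)%N;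
    under eq_bigr do rewrite local_sgd_step // dt; last by [].
  exact: mean_const.
by rewrite E sumrB -scaler_sumr scalerBr scalerA [_^-1 * _]mulrC.
Qed.

Lemma communicated t i w : (t <= T)%N -> (tau %| t)%N -> x t i w = xb t w.
Proof.
case: t => [|t] tT dt; rewrite /xb /worker_mean.
  under eq_bigr do rewrite sgd0.
  by rewrite sgd0 mean_const.
under eq_bigr do rewrite local_sgd_step // dt.
by rewrite local_sgd_step // dt mean_const.
Qed.

Hypothesis lf : forall i, lipschitz_gradient L (f i).
Hypothesis mG : forall i, borel_function (@G i).

(** The indices of the oracle calls made before time [t]; [meas K U] says that [U] is
    determined, in a measurable way, by the calls with index in [K]. *)
Let past t : {set 'I_n * 'I_T} := [set k : 'I_n * 'I_T | (k.2 < t)%N]%SET.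
Let Om K := sigma_of (Y := Y) K.
Let meas K (U : Omega -> 'rV[R]_d) :=
  measurable_fun [set: Om K] (U : Om K -> borel_rV R d).

Lemma measurable_oracle (K : {set 'I_n * 'I_T}) t i : (past t \subset K) ->
  meas (past t) (x t i) -> forall tT : (t < T)%N, (i, Ordinal tT) \in K ->
  meas K (g t i).
Proof.
move=> pK mx tT iK.
have mp : measurable_fun setT
   (fun w : Om K => (x t i w : borel_rV R d, Y (i, Ordinal tT) w)).
  apply: measurable_fun_pair; first exact: sub_sigma_of pK mx.
  exact: measurable_sigma_of.
have := @mG i; rewrite /borel_function => mGi.
exact: (measurableT_comp mGi mp).
Qed.

Lemma past_sub s t : (s <= t)%N -> past s \subset past t.
Proof. by move=> st; apply/fintype.subsetP => k; rewrite !inE => ks; lia. Qed.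

Lemma measurable_iterate t i : (t <= T)%N -> meas (past t) (x t i).
Proof.
elim: t i => [|t IH] i tT.
  have -> : x 0%N i = cst x0 by apply/funext => w; rewrite sgd0.
  exact: measurable_cst.
have mstep j : meas (past t.+1) (fun w => x t j w - eta *: g t j w).
  apply: measurable_rVB.
    by apply: (sub_sigma_of (past_sub (leqnSn t))); apply: IH; lia.
  apply: measurable_rVZ.
  apply: (measurable_oracle (past_sub (leqnSn t)) (IH j _) (tT := tT)); first lia.
  by rewrite inE.
have -> : x t.+1 i = if (tau %| t.+1)%N
    then fun w => n%:R^-1 *: \sum_j (x t j w - eta *: g t j w)
    else fun w => x t i w - eta *: g t i w.
  by apply/funext => w; rewrite local_sgd_step //; case: ifP.
case: ifP => _; last exact: mstep.
by apply: measurable_rVZ; exact: measurable_rV_sum.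
Qed.

Let meas_sub (K K' : {set 'I_n * 'I_T}) (U : Omega -> 'rV[R]_d) :
  K \subset K' -> meas K U -> meas K' U.
Proof. exact: sub_sigma_of. Qed.

Lemma measurable_worker_mean t : (t <= T)%N -> meas (past t) (xb t).
Proof.
move=> tT; apply: measurable_rVZ; apply: measurable_rV_sum => i.
exact: measurable_iterate.
Qed.

Hypothesis indep : mutually_independent P (fun k => Y k : Omega -> X k.1).
Hypothesis EG : forall i t z j, (t < T)%N ->
  (\int[P]_w (@G i z (xi i t w) 0 j)%:E = (grad (f i) z 0 j)%:E)%E.
Hypothesis VG : forall i t z, (t < T)%N ->
  (\int[P]_w (dot (@G i z (xi i t w) - grad (f i) z)
                  (@G i z (xi i t w) - grad (f i) z))%:E <= (sigma ^+ 2)%:E)%E.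

(** The noise of worker [i] at time [t]. *)
Let N t i w := g t i w - grad (f i) (x t i w).

Lemma measurable_noise (K : {set 'I_n * 'I_T}) t i : (past t \subset K) ->
  forall tT : (t < T)%N, (i, Ordinal tT) \in K -> meas K (N t i).
Proof.
move=> pK tT iK; have mx := measurable_iterate i (ltnW tT).
apply: measurable_rVB; first by have := measurable_oracle pK mx iK; apply.
by apply: (measurable_grad L0 (lf i)); exact: meas_sub pK mx.
Qed.

Lemma sq_dist_noise (K : {set 'I_n * 'I_T}) t i (c : R) (V : Omega -> 'rV[R]_d) :
  (past t \subset K) -> forall tT : (t < T)%N, (i, Ordinal tT) \notin K ->
  meas K V ->
  (\int[P]_w (dot (V w - c *: N t i w) (V w - c *: N t i w))%:E
   <= \int[P]_w (dot (V w) (V w))%:E + (c ^+ 2 * sigma ^+ 2)%:E)%E.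
Proof.
move=> pK tT iK mV.
have mx := meas_sub pK (measurable_iterate i (ltnW tT)).
have := @sq_dist_oracle R d dO Omega P _ dX _ Y indep K (i, Ordinal tT)
  (@G i) (grad (f i)) (sigma ^+ 2) c (x t i) V iK (@mG i).
apply => //.
- by move=> z j; exact: EG.
- by move=> z; exact: VG.
- exact: (measurable_grad L0 (lf i) mx).
- exact: sqr_ge0.
Qed.

(** The noises of the workers are added one at a time, each being independent of
    the past and of those already added. *)
Lemma sq_dist_mean_noise t (c : R) (V : Omega -> 'rV[R]_d) : (t < T)%N ->
  meas (past t) V ->
  (\int[P]_w (dot (V w - c *: \sum_i N t i w) (V w - c *: \sum_i N t i w))%:E
   <= \int[P]_w (dot (V w) (V w))%:E + (n%:R * (c ^+ 2 * sigma ^+ 2))%:E)%E.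
Proof.
move=> tT mV.
(* [K s] adds to the past the calls made at time [t] by the workers in [s]. *)
pose K (s : seq 'I_n) : {set 'I_n * 'I_T} :=
  (past t :|: [set k : 'I_n * 'I_T | (k.1 \in s) && (k.2 == Ordinal tT)])%SET.
have pK s : past t \subset K s by exact: finset.subsetUl.
pose W s w := V w - c *: \sum_(i <- s) N t i w.
suff [_] : meas (K (index_enum 'I_n)) (W (index_enum 'I_n)) /\
  (\int[P]_w (dot (W (index_enum 'I_n) w) (W (index_enum 'I_n) w))%:E
   <= \int[P]_w (dot (V w) (V w))%:E
      + ((size (index_enum 'I_n))%:R * (c ^+ 2 * sigma ^+ 2))%:E)%E.
  by rewrite -[index_enum _]enumT -cardT card_ord.
elim: (index_enum 'I_n) (index_enum_uniq 'I_n) => [_|i s IH /= /andP[is_ us]].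
  have -> : W [::] = V.
    by apply/funext => w; rewrite /W big_nil scaler0 subr0.
  by split; [exact: meas_sub mV|rewrite mul0r adde0].
have [mW IW] := IH us.
have iK : (i, Ordinal tT) \notin K s.
  by rewrite !inE /= ltnn (negbTE is_).
have KK : K s \subset K (i :: s).
  apply/fintype.subsetP => k; rewrite !inE => /orP[->//|/andP[-> ->]].
  by rewrite !orbT.
have -> : W (i :: s) = fun w => W s w - c *: N t i w.
  apply/funext => w; rewrite /W big_cons scalerDr opprD addrA addrAC.
  by [].
split.
  apply: measurable_rVB; first exact: meas_sub mW.
  apply: measurable_rVZ; apply: (@measurable_noise _ t i (pK _) tT).
  by rewrite !inE /= !eqxx orbT.
apply: (le_trans (@sq_dist_noise (K s) t i c (W s) (pK s) tT iK mW)).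
apply: (le_trans (leeD2r _ IW)).
by rewrite -addeA -EFinD leeD2l // lee_fin /= -natr1 mulrDl mul1r.
Qed.

Hypothesis cf : forall i, convex_function [set: convex_lmodType 'rV[R]_d] (f i).
Hypothesis het : forall u,
  n%:R^-1 * \sum_i norm2 (grad (f i) u - grad F u) ^+ 2 <= zeta ^+ 2.
Hypothesis fmin : forall z, F xs <= F z.
Hypothesis etaL : 4 * L * eta <= 1.

Let etaL1 : eta * L <= 1.
Proof. have : 0 <= eta * L by rewrite mulr_ge0 ?ltW. by move: etaL; nra. Qed.

Let measO (K : {set 'I_n * 'I_T}) (U : Omega -> 'rV[R]_d) :
  meas K U -> measurable_fun [set: Omega] (U : Omega -> borel_rV R d).
Proof. exact: sigma_of_measurable. Qed.

(** The expected dispersion of the local iterates, summed (not averaged) over the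
    workers, the expected squared distance of the mean iterate to the minimizer, and
    its expected optimality gap. They may a priori be infinite. *)
Let dispersion t : \bar R :=
  (\sum_i \int[P]_w (dot (x t i w - xb t w) (x t i w - xb t w))%:E)%E.
Let sqdist t : \bar R := (\int[P]_w (dot (xb t w - xs) (xb t w - xs))%:E)%E.
Let gap t : \bar R := (\int[P]_w (F (xb t w) - F xs)%:E)%E.

Lemma measurable_gap t : (t <= T)%N ->
  measurable_fun [set: Omega] (fun w => F (xb t w) - F xs).
Proof.
move=> tT; apply: measurable_funB => //.
have cF : continuous F.
  by move=> z; apply: differentiable_continuous; exact: differentiable_objective.
exact: (measurableT_comp (continuous_measurable_rV cF)
  (measO (measurable_worker_mean tT))).
Qed.

Lemma gap_nonneg z : 0 <= F z - F xs.
Proof. by rewrite subr_ge0. Qed.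

Lemma sqdist_step t : (t < T)%N ->
  (sqdist t.+1 + eta%:E * gap t <= sqdist t
    + (3 / 2 * eta * L * n%:R^-1)%:E * dispersion t
    + (eta ^+ 2 * sigma ^+ 2 / n%:R)%:E)%E.
Proof.
move=> tT; have tT' := ltnW tT.
pose h w := n%:R^-1 *: \sum_i grad (f i) (x t i w).
pose A w := xb t w - xs - eta *: h w.
have mxb := measurable_worker_mean tT'.
have mx i := measurable_iterate i tT'.
have mA : meas (past t) A.
  apply: measurable_rVB.
    by apply: measurable_rVB => //; exact: measurable_cst.
  apply: measurable_rVZ; apply: measurable_rVZ; apply: measurable_rV_sum => i.
  exact: (measurable_grad L0 (lf i) (mx i)).
have mg := measurable_gap tT'.
have mdA := measurable_dot (measO mA).
have mdx i : measurable_fun [set: Omega]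
    (fun w => dot (x t i w - xb t w) (x t i w - xb t w)).
  by apply: measurable_dot; apply: measurable_rVB; [exact: measO (mx i)|exact: measO mxb].
have mds : measurable_fun [set: Omega] (fun w => dot (xb t w - xs) (xb t w - xs)).
  apply: measurable_dot; apply: measurable_rVB; first exact: measO mxb.
  exact: measurable_cst.
(* [A] is the step with exact gradients, to which the noise is added. *)
have H1 : (sqdist t.+1 <= \int[P]_w (dot (A w) (A w))%:E
    + (eta ^+ 2 * sigma ^+ 2 / n%:R)%:E)%E.
  have := sq_dist_mean_noise (eta / n%:R) tT mA.
  have -> : n%:R * ((eta / n%:R) ^+ 2 * sigma ^+ 2) = eta ^+ 2 * sigma ^+ 2 / n%:R.
    by field.
  apply: le_trans; rewrite le_eqVlt; apply/orP; left; apply/eqP.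
  apply: eq_integral => w _.
  have -> : xb t.+1 w - xs = A w - (eta / n%:R) *: \sum_i N t i w; last by [].
  rewrite worker_mean_step // /A /h /N sumrB scalerBr scalerA.
  by rewrite opprB addrA subrK addrAC.
have H2 : (\int[P]_w (dot (A w) (A w))%:E + eta%:E * gap t <=
    sqdist t + (3 / 2 * eta * L * n%:R^-1)%:E * dispersion t)%E.
  have c0 : 0 <= 3 / 2 * eta * L * n%:R^-1.
    by rewrite !mulr_ge0 ?invr_ge0 ?ler0n // ltW.
  rewrite /gap /dispersion /sqdist -ge0_integral_sum_EFin //; last first.
    by move=> i w; exact: dot_ge0.
  rewrite -!ge0_integralZ_EFin //; [|exact: measurable_sum
     |by move=> w; apply: sumr_ge0 => i _; exact: dot_ge0
     |by move=> w; exact: gap_nonneg|exact: ltW].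
  rewrite -!ge0_integralD_EFin //.
  - apply: ge0_le_integral_EFin.
    + by apply: measurable_funD => //; exact: measurable_funM.
    + apply: measurable_funD => //; apply: measurable_funM => //.
      exact: measurable_sum.
    + by move=> w; rewrite addr_ge0 ?dot_ge0 // mulr_ge0 ?gap_nonneg // ltW.
    + move=> w; have := averaged_step n0 L0 lf cf (fun i => x t i w) (xb t w)
        eta0 etaL fmin.
      by rewrite [_ * (n%:R^-1 * _)]mulrA; apply.
  - by apply: measurable_funM => //; exact: measurable_sum.
  - by move=> w; exact: dot_ge0.
  - by move=> w; rewrite mulr_ge0 //; apply: sumr_ge0 => i _; exact: dot_ge0.
  - exact: measurable_funM.
  - by move=> w; exact: dot_ge0.
  - by move=> w; rewrite mulr_ge0 ?gap_nonneg // ltW.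
apply: (le_trans (leeD2r _ H1)); rewrite addeAC.
exact: leeD2r H2.
Qed.

(** [n * B] bounds the additive increase of [dispersion] in a local step. *)
Let B := (1 + tau%:R) * eta ^+ 2 * zeta ^+ 2 + eta ^+ 2 * sigma ^+ 2.

Lemma dispersion_step t : (t < T)%N -> ~~ (tau %| t.+1)%N ->
  (dispersion t.+1 <= (1 + tau%:R^-1)%:E * dispersion t + (n%:R * B)%:E)%E.
Proof.
move=> tT ndt; have tT' := ltnW tT.
have tau0 : 0 < tau%:R :> R by rewrite ltr0n; lia.
(* The new local iterates are compared with [z] rather than with their mean; as the
   mean minimizes the sum of squared distances, this can only increase the sum. *)
pose z w := xb t w - eta *: grad F (xb t w).
pose A i w := x t i w - eta *: grad (f i) (x t i w) - z w.
have mxb := measurable_worker_mean tT'.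
have mx i := measurable_iterate i tT'.
have mz : meas (past t) z.
  apply: measurable_rVB; first exact: mxb.
  apply: measurable_rVZ.
  exact: (measurable_grad L0 (lipschitz_gradient_objective n0 L0 lf) mxb).
have mA i : meas (past t) (A i).
  apply: measurable_rVB; last exact: mz.
  apply: measurable_rVB; first exact: mx.
  by apply: measurable_rVZ; exact: (measurable_grad L0 (lf i) (mx i)).
have mdA i := measurable_dot (measO (mA i)).
have mdx s i : (s <= T)%N -> measurable_fun [set: Omega]
    (fun w => dot (x s i w - xb s w) (x s i w - xb s w)).
  move=> sT; apply: measurable_dot; apply: measurable_rVB.
    exact: measO (measurable_iterate i sT).
  exact: measO (measurable_worker_mean sT).
have mxz i : measurable_fun [set: Omega]
    (fun w => dot (x t.+1 i w - z w) (x t.+1 i w - z w)).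
  apply: measurable_dot; apply: measurable_rVB.
    exact: measO (measurable_iterate i tT).
  exact: measO mz.
have H1 : (dispersion t.+1 <=
    \sum_i \int[P]_w (dot (x t.+1 i w - z w) (x t.+1 i w - z w))%:E)%E.
  rewrite /dispersion -!ge0_integral_sum_EFin //;
    do ?[by move=> i w; exact: dot_ge0|by move=> i; exact: mdx].
  apply: ge0_le_integral_EFin.
  - by apply: measurable_sum => i; exact: mdx.
  - exact: measurable_sum.
  - by move=> w; apply: sumr_ge0 => i _; exact: dot_ge0.
  - by move=> w; exact: (dot_sub_mean (fun i => x t.+1 i w) (z w) n0).
have H2 i : (\int[P]_w (dot (x t.+1 i w - z w) (x t.+1 i w - z w))%:E <=
    \int[P]_w (dot (A i w) (A i w))%:E + (eta ^+ 2 * sigma ^+ 2)%:E)%E.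
  have iK : (i, Ordinal tT) \notin past t by rewrite inE /= ltnn.
  have := @sq_dist_noise (past t) t i eta (A i) (fintype.subxx _) tT iK (mA i).
  apply: le_trans; rewrite le_eqVlt; apply/orP; left; apply/eqP.
  apply: eq_integral => w _.
  have -> : x t.+1 i w - z w = A i w - eta *: N t i w; last by [].
  have alg (p q a b : 'rV[R]_d) : p - a - q = p - b - q - (a - b).
    by rewrite opprB addrA [_ - q + _]addrAC subrK addrAC.
  by rewrite local_sgd_step // (negbTE ndt) /A /N scalerBr -alg.
have H3 : (\sum_i \int[P]_w (dot (A i w) (A i w))%:E <=
    (1 + tau%:R^-1)%:E * dispersion t
    + (n%:R * ((1 + tau%:R) * eta ^+ 2 * zeta ^+ 2))%:E)%E.
  have c0 : 0 <= 1 + tau%:R^-1 :> R by rewrite addr_ge0 // invr_ge0 ltW.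
  have z0 : 0 <= n%:R * ((1 + tau%:R) * eta ^+ 2 * zeta ^+ 2).
    by rewrite mulr_ge0 // mulr_ge0 ?sqr_ge0 // mulr_ge0 ?sqr_ge0 // addr_ge0.
  rewrite /dispersion -!ge0_integral_sum_EFin //;
    do ?[by move=> i w; exact: dot_ge0|by move=> i; exact: mdx].
  rewrite -[X in (_ + X)%E](integral_probability_cst (P := P)) -ge0_integralZ_EFin //;
    do ?[by apply: measurable_sum => i; exact: mdx
        |by move=> w; apply: sumr_ge0 => i _; exact: dot_ge0].
  rewrite -ge0_integralD_EFin //.
  - apply: ge0_le_integral_EFin.
    + exact: measurable_sum.
    + apply: measurable_funD => //; apply: measurable_funM => //.
      by apply: measurable_sum => i; exact: mdx.
    + by move=> w; apply: sumr_ge0 => i _; exact: dot_ge0.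
    + move=> w.
      exact: (local_steps_dispersion n0 L0 lf cf (fun i => x t i w) eta0 etaL1
        tau0 (het (xb t w))).
  - by apply: measurable_funM => //; apply: measurable_sum => i; exact: mdx.
  - by move=> w; rewrite mulr_ge0 //; apply: sumr_ge0 => i _; exact: dot_ge0.
apply: (le_trans H1); apply: (le_trans (lee_sum _ (fun i _ => H2 i))).
rewrite big_split /= sumEFin sumr_const card_ord -[_ *+ n]mulr_natl.
apply: (le_trans (leeD2r _ H3)).
by rewrite -addeA -EFinD -mulrDr.
Qed.

Let tau0 : 0 < tau%:R :> R.
Proof. by rewrite ltr0n; lia. Qed.

Let B0 : 0 <= B.
Proof.
apply: addr_ge0; apply: mulr_ge0; rewrite ?sqr_ge0 //.
by apply: mulr_ge0; rewrite ?sqr_ge0 // addr_ge0 // ltW.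
Qed.

Lemma dispersion_communicated t : (t <= T)%N -> (tau %| t)%N -> dispersion t = 0.
Proof.
move=> tT dt; rewrite /dispersion big1 // => i _.
rewrite (eq_integral (cst 0%E)) ?integral0 // => w _.
by rewrite communicated // subrr dot0l.
Qed.

(** [t %% tau] is the number of local steps since the last communication. *)
Lemma dispersion_modn t : (t <= T)%N ->
  (dispersion t <=
    (n%:R * (B * ((t %% tau)%:R * (1 + tau%:R^-1) ^+ (t %% tau))))%:E)%E.
Proof.
have q1 : 1 <= 1 + tau%:R^-1 :> R by rewrite lerDl invr_ge0 ltW.
have q0 : 0 <= 1 + tau%:R^-1 :> R by exact: le_trans q1.
have r0 m : 0 <= n%:R * (B * (m%:R * (1 + tau%:R^-1) ^+ m)).
  exact: mulr_ge0 (ler0n _ _) (mulr_ge0 B0 (mulr_ge0 (ler0n _ _) (exprn_ge0 m q0))).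
elim: t => [|t IH] tT.
  by rewrite dispersion_communicated // lee_fin r0.
have [dt|ndt] := boolP (tau %| t.+1)%N.
  by rewrite dispersion_communicated // lee_fin r0.
apply: (le_trans (dispersion_step tT ndt)); rewrite modnS (negbTE ndt).
set m := (t %% tau)%N in IH *.
have c : (0 <= (1 + tau%:R^-1)%:E :> \bar R)%E by rewrite lee_fin.
apply: (le_trans (leeD2r _ (lee_wpmul2l c (IH (ltnW tT))))).
rewrite -EFinM -EFinD lee_fin exprS -natr1.
have := exprn_ege1 m.+1 q1; rewrite exprS.
move: (1 + _) (_ ^+ m) (m%:R) => q Q m' qQ.
have := ler_wpM2l (mulr_ge0 (ler0n R n) B0) qQ; lra.
Qed.

(** The local phases are shorter than [tau], hence the growth factor is bounded. *)
Lemma dispersion_bound t : (t <= T)%N ->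
  (dispersion t <= (3 * tau%:R * n%:R * B)%:E)%E.
Proof.
move=> tT; apply: (le_trans (dispersion_modn tT)); rewrite lee_fin.
have -> : 3 * tau%:R * n%:R * B = n%:R * (B * (tau%:R * 3)) by ring.
rewrite ler_wpM2l ?ler0n // ler_wpM2l //.
have mt : (t %% tau <= tau)%N by apply: ltnW; rewrite ltn_mod; lia.
apply: ler_pM; rewrite ?ler0n ?ler_nat //.
exact: exp_succ_inv_le3.
Qed.

(** The total error committed in one step. *)
Let K := 3 / 2 * eta * L * n%:R^-1 * (3 * tau%:R * n%:R * B)
  + eta ^+ 2 * sigma ^+ 2 / n%:R.

Lemma telescoped_gaps t : (t <= T)%N ->
  (sqdist t + \sum_(s < t) eta%:E * gap s <=
    (dot (x0 - xs) (x0 - xs) + t%:R * K)%:E)%E.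
Proof.
have c0 : (0 <= (3 / 2 * eta * L * n%:R^-1)%:E :> \bar R)%E.
  by rewrite lee_fin !mulr_ge0 ?invr_ge0 ?ler0n // ltW.
elim: t => [|t IH] tT.
  rewrite big_ord0 adde0 mul0r addr0 /sqdist.
  under eq_integral => w _ do
    rewrite -(communicated (Ordinal n0) w (leq0n T) (dvdn0 tau)) sgd0.
  by rewrite integral_probability_cst.
rewrite big_ord_recr /= addeCA addeC.
apply: (le_trans (leeD2r _ (sqdist_step tT))).
have H := dispersion_bound (ltnW tT).
have H' := leeD2r (eta ^+ 2 * sigma ^+ 2 / n%:R)%:E
  (leeD2l (sqdist t) (lee_wpmul2l c0 H)).
apply: (le_trans (leeD2r _ H')).
rewrite -EFinM -[X in (X + _ <= _)%E]addeA -EFinD addeAC.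
rewrite -/K -[t.+1%:R]natr1 mulrDl mul1r addrA [leRHS]EFinD.
by apply: leeD2r; exact: IH (ltnW tT).
Qed.

Lemma gap_ge0 t : (0 <= gap t)%E.
Proof. by apply: integral_ge0 => w _; rewrite lee_fin gap_nonneg. Qed.

Lemma sum_gaps : (\sum_(t < T) gap t <=
  ((dot (x0 - xs) (x0 - xs) + T%:R * K) / eta)%:E)%E.
Proof.
have := telescoped_gaps (leqnn T).
rewrite -ge0_sume_distrr; last by move=> t _; exact: gap_ge0.
move=> H; rewrite mulrC EFinM lee_pdivlMl //; apply: le_trans H.
by rewrite leeDr // integral_ge0 // => w _; rewrite lee_fin dot_ge0.
Qed.

Lemma mean_gap : (0 < T)%N ->
  ((T%:R^-1)%:E * \sum_(t < T) \int[P]_w (F (xb t w))%:E - (F xs)%:E <=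
   (T%:R^-1 * ((dot (x0 - xs) (x0 - xs) + T%:R * K) / eta))%:E)%E.
Proof.
move=> T0; have TR : 0 < T%:R :> R by rewrite ltr0n.
(* The bound on the sum makes each gap finite, hence [F (xb t)] integrable. *)
have gfin (t : 'I_T) : gap t \is a fin_num.
  rewrite ge0_fin_numE ?gap_ge0 //; apply: le_lt_trans (ltry _).
  apply: le_trans sum_gaps; rewrite (bigD1 t) //= leeDl //.
  by apply: sume_ge0 => s _; exact: gap_ge0.
have EF (t : 'I_T) : (\int[P]_w (F (xb t w))%:E = gap t + (F xs)%:E)%E.
  rewrite -[X in (_ + X)%E](integral_probability_cst (P := P)) -integralD //.
  - by apply: eq_integral => w _; rewrite -EFinD subrK.
  - apply/integrableP; split; first exact/measurable_EFinP/measurable_gap/ltnW.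
    rewrite (eq_integral (fun w => (F (xb t w) - F xs)%:E)).
      by rewrite -/(gap t) ltey_eq gfin.
    by move=> w _; rewrite gee0_abs // lee_fin gap_nonneg.
  - exact: finite_measure_integrable_cst.
under eq_bigr do rewrite EF; rewrite big_split /= sumEFin sumr_const card_ord.
have gE : (\sum_(t < T) gap t = (\sum_(t < T) fine (gap t))%:E)%E.
  by rewrite -sumEFin; apply: eq_bigr => t _; rewrite fineK.
have := sum_gaps; rewrite gE lee_fin => H.
rewrite -EFinD lee_fin.
have -> : T%:R^-1 * (\sum_(i < T) fine (gap i) + F xs *+ T) - F xs =
          T%:R^-1 * \sum_(i < T) fine (gap i).
  by rewrite mulrDr -[F xs *+ T]mulr_natl mulKf ?lt0r_neq0 // addrK.
by rewrite ler_wpM2l // invr_ge0 ltW.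
Qed.

End LocalSGD.

(** * Choice of the stepsize *)

Section StepsizeChoice.
Context {R : realType}.

Lemma cube_root_cubed (a : R) : 0 <= a -> (a `^ 3%:R^-1) ^+ 3 = a.
Proof.
move=> a0; rewrite -powR_mulrn ?powR_ge0 // -powRrM mulVf ?powRr1 //.
Qed.

(** With [A = D ^+ 2 / T], each error term [b] of the bound is [A * q] for some [q],
    and [c] is the coefficient that [eta ^+ 2] (resp. [eta] in [factor_square])
    multiplies. If [A] vanishes, so do [b] and [c], and [q = 0] will do. *)
Lemma factor_cube (A b c : R) : 0 <= A -> 0 <= b -> 0 <= c ->
  b ^+ 3 = c * A ^+ 2 -> (A = 0 -> c = 0) ->
  exists q, [/\ 0 <= q, b = A * q & c = A * q ^+ 3].
Proof.
move=> A0 b0 c0 bE Ac; have [Az|Anz] := eqVneq A 0.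
  exists 0; split => //; last by rewrite Ac // expr0n mulr0.
  have : b ^+ 3 == 0 by rewrite bE Az expr0n mulr0.
  by rewrite expf_eq0 mulr0 => /eqP.
exists (b / A); split; first exact: divr_ge0.
  by rewrite mulrC divfK.
have -> : A * (b / A) ^+ 3 = b ^+ 3 / A ^+ 2 by field.
by rewrite bE mulfK // expf_neq0.
Qed.

Lemma factor_square (A b c : R) : 0 <= A -> 0 <= b -> 0 <= c ->
  b ^+ 2 = c * A -> (A = 0 -> c = 0) ->
  exists q, [/\ 0 <= q, b = A * q & c = q * b].
Proof.
move=> A0 b0 c0 bE Ac; have [Az|Anz] := eqVneq A 0.
  exists 0; split => //; last by rewrite Ac // mul0r.
  have : b ^+ 2 == 0 by rewrite bE Az mulr0.
  by rewrite expf_eq0 mulr0 => /eqP.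
exists (b / A); split; first exact: divr_ge0.
  by rewrite mulrC divfK.
by rewrite mulrAC -expr2 bE mulfK.
Qed.

(** The inverse stepsize is the sum of the inverse stepsizes that balance
    [D ^+ 2 / (eta * T)] against each of the error terms. *)
Lemma stepsize_choice (n tau r : nat) (L sigma zeta D : R) :
  (0 < n)%N -> (2 <= tau)%N -> (0 < r)%N ->
  0 < L -> 0 <= sigma -> 0 <= zeta -> 0 <= D ->
  (D = 0 -> sigma = 0 /\ zeta = 0) ->
  exists eta : R, [/\ 0 < eta, 4 * L * eta <= 1 &
  forall e, e <= D ^+ 2 ->
  (tau * r)%:R^-1 * ((e + (tau * r)%:R *
    (3 / 2 * eta * L * n%:R^-1 * (3 * tau%:R * n%:R *
       ((1 + tau%:R) * eta ^+ 2 * zeta ^+ 2 + eta ^+ 2 * sigma ^+ 2))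
     + eta ^+ 2 * sigma ^+ 2 / n%:R)) / eta)
  <= 10 * (L * D ^+ 2 / (tau%:R * r%:R)
      + sigma * D / Num.sqrt (n%:R * tau%:R * r%:R)
      + (L * zeta ^+ 2 * D ^+ 4 / r%:R ^+ 2) `^ (3%:R^-1)
      + (L * sigma ^+ 2 * D ^+ 4 / (tau%:R * r%:R ^+ 2)) `^ (3%:R^-1))].
Proof.
move=> n0 tau2 r0 L0 s0 z0 D0 deg; rewrite natrM.
have nR : 0 < n%:R :> R by rewrite ltr0n.
have rR : 0 < r%:R :> R by rewrite ltr0n.
have tR : 2 <= tau%:R :> R by rewrite (ler_nat R 2).
move: (n%:R) (r%:R) (tau%:R) nR rR tR => N rho t N0 rho0 t2.
have t0 : 0 < t by lra.
have [L0' N0' rho0' t0'] : [/\ 0 <= L, 0 <= N, 0 <= rho & 0 <= t].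
  by split; exact: ltW.
pose A := D ^+ 2 / (t * rho).
have A0 : 0 <= A by rewrite divr_ge0 ?sqr_ge0 // mulr_ge0.
have Az : A = 0 -> sigma = 0 /\ zeta = 0.
  move=> /eqP; rewrite mulf_eq0 invr_eq0 (gt_eqF (mulr_gt0 t0 rho0)) orbF expf_eq0 /=.
  by move=> /eqP /deg.
set b2 := sigma * D / _; set a3 := L * zeta ^+ 2 * _ / _.
set a4 := L * sigma ^+ 2 * _ / _.
have b20 : 0 <= b2 by rewrite divr_ge0 ?sqrtr_ge0 // mulr_ge0.
have a30 : 0 <= a3.
  by rewrite divr_ge0 ?exprn_ge0 // !mulr_ge0 ?exprn_ge0.
have a40 : 0 <= a4.
  by rewrite divr_ge0 // !mulr_ge0 ?exprn_ge0.
have [p [p0 b2E pE]] : exists q, [/\ 0 <= q, b2 = A * q & sigma ^+ 2 / N = q * b2].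
  apply: factor_square => //; first by rewrite divr_ge0 ?sqr_ge0.
    rewrite /b2 expr_div_n sqr_sqrtr ?mulr_ge0 // /A; field.
    by rewrite !gt_eqF.
  by move=> /Az[-> _]; rewrite expr0n mul0r.
have [q [q0 b3E qE]] : exists q,
    [/\ 0 <= q, a3 `^ 3%:R^-1 = A * q & L * t ^+ 2 * zeta ^+ 2 = A * q ^+ 3].
  apply: factor_cube => //.
  - exact: powR_ge0.
  - by rewrite !mulr_ge0 ?sqr_ge0.
  - by rewrite cube_root_cubed // /a3 /A; field; rewrite !gt_eqF.
  - by move=> /Az[_ ->]; rewrite expr0n mulr0.
have [s [s1 b4E sE]] : exists q,
    [/\ 0 <= q, a4 `^ 3%:R^-1 = A * q & L * t * sigma ^+ 2 = A * q ^+ 3].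
  apply: factor_cube => //.
  - exact: powR_ge0.
  - by rewrite !mulr_ge0 ?sqr_ge0.
  - by rewrite cube_root_cubed // /a4 /A; field; rewrite !gt_eqF.
  - by move=> /Az[-> _]; rewrite expr0n mulr0.
(* [M] is the inverse stepsize. *)
pose M := 4 * L + p + q + s.
have M0 : 0 < M by rewrite /M; lra.
exists M^-1; set eta := M^-1; have eta0 : 0 < eta by rewrite invr_gt0.
have le1 y : 0 <= y -> y <= M -> eta * y <= 1.
  by move=> y0 yM; rewrite mulrC ler_pdivrMr // mul1r.
split => //; first by rewrite mulrC; apply: le1; rewrite /M; lra.
move=> e eD; rewrite b3E b4E.
have -> : (t * rho)^-1 * ((e + t * rho *
    (3 / 2 * eta * L * N^-1 * (3 * t * N *
       ((1 + t) * eta ^+ 2 * zeta ^+ 2 + eta ^+ 2 * sigma ^+ 2))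
     + eta ^+ 2 * sigma ^+ 2 / N)) / eta) =
  e / (t * rho) * M + 9 / 2 * eta ^+ 2 * (L * t * (1 + t) * zeta ^+ 2)
    + 9 / 2 * eta ^+ 2 * (L * t * sigma ^+ 2) + eta * (sigma ^+ 2 / N).
  by rewrite /eta; field; rewrite !gt_eqF.
have h1 : e / (t * rho) * M <= A * M.
  have h0 : e / (t * rho) <= A by rewrite ler_wpM2r // invr_ge0 mulr_ge0.
  exact: (ler_wpM2r (ltW M0) h0).
have h2 : L * t * (1 + t) * zeta ^+ 2 <= 3 / 2 * (A * q ^+ 3).
  rewrite -qE; have : 0 <= L * t * zeta ^+ 2 by rewrite !mulr_ge0 ?sqr_ge0.
  by nra.
have sq1 y : 0 <= y -> y <= M -> eta ^+ 2 * (A * y ^+ 3) <= A * y.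
  move=> y0 yM; have -> : eta ^+ 2 * (A * y ^+ 3) = A * y * (eta * y) ^+ 2 by ring.
  apply: (ler_piMr (mulr_ge0 A0 y0)); apply: exprn_ile1; last exact: le1.
  by rewrite mulr_ge0 // ltW.
have h3 : eta ^+ 2 * (A * q ^+ 3) <= A * q by apply: sq1 => //; rewrite /M; lra.
have h4 : eta ^+ 2 * (A * s ^+ 3) <= A * s by apply: sq1 => //; rewrite /M; lra.
have h5 : eta * (sigma ^+ 2 / N) <= b2.
  by rewrite pE mulrA ler_piMl // le1 //; rewrite /M; lra.
have h6 : eta ^+ 2 * (L * t * (1 + t) * zeta ^+ 2) <= 3 / 2 * (A * q).
  apply: le_trans (ler_wpM2l (sqr_ge0 eta) h2) _.
  by rewrite mulrCA ler_wpM2l.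
rewrite sE.
have AM : A * M = 4 * (L * A) + b2 + A * q + A * s by rewrite b2E /M; ring.
(* The four terms of the bound come with the coefficients 4, 2, 31/4 and 11/2. *)
have LA : 0 <= L * A by rewrite mulr_ge0.
have Aq : 0 <= A * q by rewrite mulr_ge0.
have As : 0 <= A * s by rewrite mulr_ge0.
have -> : L * D ^+ 2 / (t * rho) = L * A by rewrite /A mulrA.
by lra.
Qed.

End StepsizeChoice.

(** * The convergence bound *)

Lemma inf_range_min (R : realType) (V : Type) (F : V -> R) (z : V) :
  (forall y, F z <= F y) -> inf (range F) = F z.
Proof.
move=> Fz; apply/eqP; rewrite eq_le; apply/andP; split.
  apply: ge_inf; last by exists z.
  by exists (F z) => _ [y _ <-].
by apply: lb_le_inf; [exists (F z), z|move=> _ [y _ <-]].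
Qed.

Unset Implicit Arguments.
Set Strict Implicit.

Theorem theorem2 (R : realType) :
  exists C : R, 0 < C /\
  forall (n d tau r T : nat) (L sigma zeta D : R)
         (f : 'I_n -> 'rV[R]_d -> R)
         (dO : measure_display) (Omega : measurableType dO)
         (P : probability Omega R)
         (dX : measure_display) (X : 'I_n -> measurableType dX)
         (G : forall i : 'I_n, 'rV[R]_d -> X i -> 'rV[R]_d)
         (xi : forall i : 'I_n, nat -> {RV P >-> X i})
         (x0 xstar : 'rV[R]_d),
  let F := objective f in
  let fstar := inf (range F) in
  (0 < n)%N -> (2 <= tau)%N -> (0 < r)%N -> T = (tau * r)%N ->
  0 < L -> 0 <= sigma -> 0 <= zeta -> 0 <= D ->
  (D = 0 -> sigma = 0 /\ zeta = 0) ->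
  (forall i, lipschitz_gradient L (f i)) ->
  has_lbound (range F) ->
  (forall i, borel_function (G i)) ->
  (forall i (s t : nat), (s < T)%N -> (t < T)%N ->
     forall A : set (X i), measurable A ->
     distribution P (xi i s) A = distribution P (xi i t) A) ->
  mutually_independent P
    (fun (k : ('I_n * 'I_T)%type) => xi k.1 k.2 : Omega -> X k.1) ->
  (forall i (t : nat) (x : 'rV[R]_d) (j : 'I_d), (t < T)%N ->
     ('E_P[fun w => (G i x (xi i t w) 0 j)%R] = (grad (f i) x 0 j)%R%:E)%E) ->
  (forall i (t : nat) (x : 'rV[R]_d), (t < T)%N ->
     ('E_P[fun w => (norm2 (G i x (xi i t w) - grad (f i) x) ^+ 2)%R]
        <= (sigma ^+ 2)%:E)%E) ->
  (ereal_sup (range (fun x : 'rV[R]_d =>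
      (n%:R^-1 * \sum_(i < n) norm2 (grad (f i) x - grad F x) ^+ 2)%:E))
     <= (zeta ^+ 2)%:E)%E ->
  (forall i, convex_function [set: convex_lmodType 'rV[R]_d] (f i)) ->
  (forall x, F xstar <= F x) ->
  norm2 (x0 - xstar) <= D ->
  exists eta : R, 0 < eta /\
  forall x : nat -> 'I_n -> Omega -> 'rV[R]_d,
  local_sgd tau T eta G xi x0 x ->
  ((T%:R^-1)%:E * \sum_(t < T) 'E_P[fun w => F (worker_mean (x t) w)]
     - fstar%:E
   <= (C * (L * D ^+ 2 / (tau%:R * r%:R)
            + sigma * D / Num.sqrt (n%:R * tau%:R * r%:R)
            + (L * zeta ^+ 2 * D ^+ 4 / r%:R ^+ 2) `^ (3%:R^-1)
            + (L * sigma ^+ 2 * D ^+ 4 / (tau%:R * r%:R ^+ 2)) `^ (3%:R^-1)))%:E)%E.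

Proof.
exists 10; split => // n d tau r T L sigma zeta D f dO Omega P dX X G xi x0 xstar
  F fstar n0 tau2 r0 TE L0 s0 z0 D0 deg lf _ mG _ indep EG VG het cf fmin x0D.
subst T.
have T0 : (0 < tau * r)%N by rewrite muln_gt0 r0 andbT ltnW.
have [eta [eta0 etaL bound]] := stepsize_choice n0 tau2 r0 L0 s0 z0 D0 deg.
exists eta; split => // x sgd.
have -> : fstar = F xstar.
  apply: inf_range_min; exact: fmin.
have EG' i t y j : (t < tau * r)%N ->
    (\int[P]_w (G i y (xi i t w) 0 j)%:E = (grad (f i) y 0 j)%:E)%E.
  by move=> tT; have := EG i t y j tT; rewrite expectation.unlock.
have VG' i t y : (t < tau * r)%N ->
    (\int[P]_w (dot (G i y (xi i t w) - grad (f i) y)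
                    (G i y (xi i t w) - grad (f i) y))%:E <= (sigma ^+ 2)%:E)%E.
  move=> tT; have := VG i t y tT; rewrite expectation.unlock.
  by under eq_integral do rewrite norm2_sq.
have het' u : n%:R^-1 * \sum_i norm2 (grad (f i) u - grad F u) ^+ 2 <= zeta ^+ 2.
  rewrite -lee_fin; apply: le_trans het; apply: ereal_sup_ubound.
  by exists u.
have H := mean_gap n0 tau2 L0 eta0 sgd lf mG indep EG' VG' cf het' fmin etaL T0.
rewrite expectation.unlock; apply: (le_trans H); rewrite lee_fin; apply: bound.
by rewrite -norm2_sq ler_pXn2r ?nnegrE ?norm2_ge0.
Qed.
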